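(* Fix $t_0>0$, $\nu>0$ and $0<\alpha<1$. For $K=2\pi n$, $n\in\mathbb{N}$, let $a_K:=\nu K^{1-\alpha}$ and $b_K(x,y,z):=a_K\sin(Ky)\,e_1$, a smooth divergence-free field on $\mathbb{T}^3$, and let $A^K_t$ be the inverse of the stochastic flow $\mathrm{d}X_t=b_K(X_t)\,\mathrm{d}t+\sqrt{2\nu}\,\mathrm{d}W_t$. There is a constant $C_\alpha$ independent of $K$ such that $$\|\mathbb{E}\nabla A^K_{t_0}\|_{C^\alpha}\le C_\alpha,$$ while there is a universal constant $c>0$ such that, whenever $\nu K^2t_0\ge2$, $$\mathbb{E}\|\nabla A^K_{t_0}\|_{L^\infty}\ \ge\ c\,\sqrt{\nu t_0}\;K^{1-\alpha},$$ and the right-hand side tends to $\infty$ as $K\to\infty$.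
   Context: $\mathbb{T}^3=\mathbb{R}^3/\mathbb{Z}^3$ with coordinates $(x,y,z)$ and first basis vector $e_1$. $W$ is a single 3-dimensional Brownian motion common to all starting points, $X_0(a)=a$, $A^K_t:=X_t^{-1}$; $(\nabla A)_{ij}=\partial_jA_i$; matrix norms are operator norms; $\|\cdot\|_{C^\alpha}$ is the sup norm plus the $\alpha$-Hölder seminorm; expectations of fields are taken pointwise. *)

(* Defs.v *)
From HB Require Import structures.
From mathcomp Require Import all_boot all_order all_algebra.
From mathcomp Require Import all_classical all_reals all_analysis.
From mathcomp Require Import ess_sup_inf.

Set Implicit Arguments.
Unset Strict Implicit.
Unset Printing Implicit Defensive.

Import Order.TTheory GRing.Theory Num.Theory.
Import numFieldNormedType.Exports.

Local Open Scope classical_set_scope.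
Local Open Scope ring_scope.

(* MathComp-Analysis, over an arbitrary R : realType.  Points of the torus
   R^3/Z^3 are represented by vectors of R^3, fields on the torus by
   Z^3-periodic functions on R^3, and flows on the torus by their lifts to R^3.
   Coordinates are numbered 0, 1, 2. *)

(** * Norms *)

(* The library's norm on matrices is the max norm, hence these two. *)
Definition enorm {R : realType} (v : 'cV[R]_3) : R :=
  Num.sqrt (\sum_(i < 3) v i 0 ^+ 2).

Definition opnorm {R : realType} (M : 'M[R]_3) : R :=
  sup [set enorm (M *m v) | v in [set v : 'cV[R]_3 | enorm v <= 1]].

Definition lattice_vec {R : realType} (m : 'cV[int]_3) : 'cV[R]_3 :=
  \col_i (m i 0)%:~R.

Definition torus_dist {R : realType} (x y : 'cV[R]_3) : R :=
  inf [set enorm (x - y - lattice_vec m) | m in [set: 'cV[int]_3]].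

Definition z3_periodic {R : realType} {T : Type} (f : 'cV[R]_3 -> T) : Prop :=
  forall x m, f (x + lattice_vec m) = f x.

Definition sup_opnorm {R : realType} (F : 'cV[R]_3 -> 'M[R]_3) : \bar R :=
  ereal_sup [set (opnorm (F x))%:E | x in [set: 'cV[R]_3]].

(* The pairs are those of distinct points of the torus. *)
Definition holder_seminorm {R : realType} (al : R) (F : 'cV[R]_3 -> 'M[R]_3) :
    \bar R :=
  ereal_sup [set (opnorm (F p.1 - F p.2) / (torus_dist p.1 p.2 `^ al))%:E
            | p in [set p : 'cV[R]_3 * 'cV[R]_3 | torus_dist p.1 p.2 != 0]].

Definition holder_norm {R : realType} (al : R) (F : 'cV[R]_3 -> 'M[R]_3) :
    \bar R :=
  (sup_opnorm F + holder_seminorm al F)%E.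

Definition vec3 {R : realType} (p : R * R * R) : 'cV[R]_3 :=
  \col_i [:: p.1.1; p.1.2; p.2]`_i.

(* For a periodic F, the essential supremum over R^3 is the one over the
   torus. *)
Definition Linfty_norm {R : realType} (F : 'cV[R]_3 -> 'M[R]_3) : \bar R :=
  ess_sup ((@lebesgue_measure R \x @lebesgue_measure R)
             \x @lebesgue_measure R)%E
          (fun p : R * R * R => (opnorm (F (vec3 p)))%:E).

(** * Differential calculus *)

Definition partial_d {R : realType} (j : 'I_3) (f : 'cV[R]_3 -> R) :
    'cV[R]_3 -> R :=
  fun x => 'D_(delta_mx j 0) f x.

Definition smooth3 {R : realType} (f : 'cV[R]_3 -> R) : Prop :=
  forall s : seq 'I_3,
    continuous (foldr partial_d f s) /\
    forall j x, derivable (foldr partial_d f s) x (delta_mx j 0).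

Definition component {R : realType} (A : 'cV[R]_3 -> 'cV[R]_3) (i : 'I_3) :
    'cV[R]_3 -> R :=
  fun x => A x i 0.

Definition divergence {R : realType} (b : 'cV[R]_3 -> 'cV[R]_3) (x : 'cV[R]_3) : R :=
  \sum_(i < 3) partial_d i (component b i) x.

Definition grad {R : realType} (A : 'cV[R]_3 -> 'cV[R]_3) (x : 'cV[R]_3) :
    'M[R]_3 :=
  \matrix_(i, j) partial_d j (component A i) x.

(** * Brownian motion *)

(* As B i may be setT, the product rule over the whole finite family contains
   the one over its subfamilies. *)
Definition mutually_independent {R : realType} {d : measure_display}
    {Om : measurableType d} (P : probability Om R) (I : finType)
    (Y : I -> Om -> R) : Prop :=
  forall B : I -> set R, (forall i, measurable (B i)) ->
    P [set om | forall i, B i (Y i om)] = (\prod_i P (Y i @^-1` B i))%E.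

(* [W t i] is the i-th coordinate of W_t; only times t >= 0 matter.  The
   increments over disjoint intervals are independent with law
   N(0, (t - s) I_3), i.e. all their coordinates are independent N(0, t - s).
   The times are strictly increasing because the library's [normal_prob 0 0] is
   not a Dirac mass; its second parameter is the standard deviation. *)
Definition brownian_motion {R : realType} {d : measure_display}
    {Om : measurableType d} (P : probability Om R)
    (W : R -> 'I_3 -> {RV P >-> R}) : Prop :=
  [/\ {ae P, forall om, forall i, W 0 i om = 0},
      {ae P, forall om, forall i,
        {within `[0, +oo[, continuous (fun t => W t i om)}},
      (forall (s t : R) i (B : set R), 0 <= s -> s < t -> measurable B ->
        P ((fun om => W t i om - W s i om) @^-1` B)
        = normal_prob 0 (Num.sqrt (t - s)) B)
    & (forall (m : nat) (t : nat -> R), 0 <= t 0%N ->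
        (forall k, t k < t k.+1) ->
        mutually_independent P (fun (ik : 'I_3 * 'I_m) om =>
          W (t ik.2.+1) ik.1 om - W (t ik.2) ik.1 om))].

(** * Stochastic flows *)

(* dX_t = b(X_t) dt + sqrt(2 nu) dW_t for all starting points at once.  As the
   noise is additive, this is a pathwise integral equation. *)
Definition stochastic_flow {R : realType} {d : measure_display}
    {Om : measurableType d} (P : probability Om R) (nu : R)
    (b : 'cV[R]_3 -> 'cV[R]_3) (W : R -> 'I_3 -> {RV P >-> R})
    (X : R -> 'cV[R]_3 -> Om -> 'cV[R]_3) : Prop :=
  {ae P, forall om, forall a : 'cV[R]_3,
    [/\ X 0 a om = a,
        {within `[0, +oo[, continuous (fun t => X t a om)}
      & forall t, 0 <= t -> forall i,
          X t a om i 0 = a i 0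
            + \int[lebesgue_measure]_(s in `[0, t]) b (X s a om) i 0
            + Num.sqrt (2 * nu) * W t i om]}.

Definition inverse_flow {R : realType} {d : measure_display}
    {Om : measurableType d} (P : probability Om R)
    (X A : R -> 'cV[R]_3 -> Om -> 'cV[R]_3) : Prop :=
  {ae P, forall om, forall t, 0 <= t ->
    cancel (fun a => X t a om) (fun a => A t a om) /\
    cancel (fun a => A t a om) (fun a => X t a om)}.

(* Here [B x om] is the value at x of a random map from R^3 to R^3. *)
Definition grad_entry {R : realType} {Om : Type}
    (B : 'cV[R]_3 -> Om -> 'cV[R]_3) (x : 'cV[R]_3) (i j : 'I_3) (om : Om) : R :=
  grad (B ^~ om) x i j.

(* [fine] sends infinite values to 0, so [mean_grad] is meaningful only
   together with [mean_grad_exists]. *)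
Definition mean_grad_exists {R : realType} {d : measure_display}
    {Om : measurableType d} (P : probability Om R)
    (B : 'cV[R]_3 -> Om -> 'cV[R]_3) : Prop :=
  forall x i j, ('E_P[grad_entry B x i j])%E \is a fin_num.

Definition mean_grad {R : realType} {d : measure_display}
    {Om : measurableType d} (P : probability Om R)
    (B : 'cV[R]_3 -> Om -> 'cV[R]_3) (x : 'cV[R]_3) : 'M[R]_3 :=
  \matrix_(i, j) fine ('E_P[grad_entry B x i j])%E.

(* The expectation of an extended-real random variable. *)
Definition mean_Linfty_grad {R : realType} {d : measure_display}
    {Om : measurableType d} (P : probability Om R)
    (B : 'cV[R]_3 -> Om -> 'cV[R]_3) : \bar R :=
  (\int[P]_om Linfty_norm (grad (B ^~ om)))%E.

(** * The shear field *)

Definition freq {R : realType} (n : nat) : R := 2 * pi * n%:R.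

Definition amplitude {R : realType} (nu al K : R) : R := nu * K `^ (1 - al).

Definition shear {R : realType} (nu al K : R) (x : 'cV[R]_3) : 'cV[R]_3 :=
  (amplitude nu al K * sin (K * x 1 0)) *: delta_mx 0 0.

(* Main.v *)
(* The shear moves only the first coordinate, so the flow is explicit and
     grad A_t = I - a_K K Phi_t(-K y) e_1 (x) e_2,
     Phi_t(b) = int_0^t cos(b + kap (w_t - w_s)) ds,  kap = K sqrt(2 nu),
   where w is the second coordinate of W.  With lam = nu K^2 = kap^2 / 2, the
   Gaussian characteristic function gives E Phi_t(b) = M cos b with
   0 <= M <= 1 / lam.  Hence E grad A_t = I - m cos(K y) e_1 (x) e_2 with
   m K^al <= 1, which bounds the Hoelder norm.  On the other hand
   E Phi_t(0)^2 >= t / (8 lam) and E Phi_t(0)^4 <= 48 (t / lam)^2, so that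
   E |Phi_t(0)| >= sqrt(t / lam) / 512 by a fourth-moment argument, and
   |a_K K Phi_t(0)| bounds the sup norm of grad A_t from below.
   Phi_t is handled through Riemann sums over uniform grids: these are
   trigonometric polynomials in finitely many i.i.d. Gaussian increments, and
   no joint measurability of (s, om) |-> W_s(om) is needed. *)

Require Import Defs.
From HB Require Import structures.
From mathcomp Require Import all_boot all_order all_algebra.
From mathcomp Require Import all_classical all_reals all_analysis.
From mathcomp Require Import measurable_realfun ess_sup_inf ring lra zify.
Import Order.TTheory GRing.Theory Num.Theory.
Import numFieldNormedType.Exports.
Local Open Scope classical_set_scope.
Local Open Scope ring_scope.

Set Implicit Arguments.
Unset Strict Implicit.
Unset Printing Implicit Defensive.

(** * Gaussian integrals *)

(** Mean and typical size differ because the phase [kap (w_t - w_s)] decorrelates in time [1 / lam]: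
    [Phi_t] behaves like a sum of about [lam t] independent pieces of size [1 / lam]. Its mean is at
    most one piece, its typical size is [sqrt(lam t) / lam = sqrt(t / lam)], and [lam t >= 2]
    provides enough pieces. The amplitude is tuned so that [a_K K K^al = lam], which exactly cancels
    the bound on the mean, whereas [a_K K sqrt(t / lam) = sqrt(nu t) K^(1 - al)]. A large second
    moment could be carried by rare large values; the fourth moment excludes this. It is of the
    order of the squared second moment because, as in Wick's formula, four times contribute only
    through their three pairings. Independence is given as a product rule for events, so the mean of
    a cosine of a sum is computed by adding one increment at a time, against weights that carry
    events. *)

Section density.
Context d1 d2 (X : measurableType d1) (Y : measurableType d2) (R : realType).
Variables (mu : {measure set X -> \bar R}) (nu : {measure set Y -> \bar R}).
Variables (phi : X -> Y) (p : X -> R).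
Hypotheses (mphi : measurable_fun [set: X] phi) (mp : measurable_fun [set: X] p).
Hypothesis p0 : forall x, 0 <= p x.
Hypothesis nuE : forall A, measurable A ->
  nu A = (\int[mu]_(x in phi @^-1` A) (p x)%:E)%E.
Local Open Scope ereal_scope.

Import HBNNSimple.

(* Radon-Nikodym and pushforward at once: [phi = id] gives integration against a
   density, and [phi = xi] tests independence of the weight [p] from [xi]. *)
Lemma ge0_integral_density (f : Y -> \bar R) :
  measurable_fun [set: Y] f -> (forall y, 0 <= f y) ->
  \int[nu]_y f y = \int[mu]_x (f (phi x) * (p x)%:E).
Proof.
move=> mf f0; pose h := nnsfun_approx (@measurableT _ Y) mf.
have mEp : measurable_fun [set: X] (EFin \o p) by exact/measurable_EFinP.
have cvgh y : (EFin \o h n) y @[n --> \oo] --> f y.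
  by apply: cvg_nnsfun_approx.
have mhphi n : measurable_fun [set: X] (fun x => (h n (phi x))%:E).
  by apply/measurable_EFinP; apply: measurableT_comp.
have -> : \int[nu]_y f y = limn (fun n => \int[nu]_y (h n y)%:E).
  under eq_integral => y _ do rewrite -(cvg_lim _ (@cvgh y))//.
  apply: monotone_convergence => //.
  - by move=> n; apply/measurable_EFinP.
  - by move=> n x _ //=; rewrite lee_fin.
  - by move=> x _ a b ab; rewrite lee_fin; exact/lefP/nd_nnsfun_approx.
have -> : \int[mu]_x (f (phi x) * (p x)%:E)
    = limn (fun n => \int[mu]_x ((h n (phi x))%:E * (p x)%:E)).
  have fg x : f (phi x) * (p x)%:E = limn (fun n => (h n (phi x))%:E * (p x)%:E).
    by apply/esym/cvg_lim => //; apply: cvgeZr => //; exact: cvgh.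
  under eq_integral => x _ do rewrite fg.
  apply: monotone_convergence => // [n|n x _|x _ a b ab].
  - exact: emeasurable_funM.
  - by rewrite mule_ge0 ?lee_fin.
  - by rewrite lee_wpmul2r ?lee_fin//; exact/lefP/nd_nnsfun_approx.
congr (limn _); apply/funext => n.
have mhr r : measurable (h n @^-1` [set r]) by [].
transitivity (\int[nu]_x
   (\sum_(y \in range (h n)) (y * \1_(h n @^-1` [set y]) x)%:E)).
  by apply: eq_integral => t tE; rewrite /= fimfunE -fsumEFin.
rewrite ge0_integral_fsum//; last 2 first.
- by move=> r; apply/measurable_EFinP/measurable_funM.
- by move=> m y Ey; exact: nnfun_muleindic_ge0.
transitivity (\int[mu]_x (\sum_(y \in range (h n))
    (y * \1_(h n @^-1` [set y]) (phi x))%:E * (p x)%:E)); last first.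
  apply: eq_integral => x _.
  rewrite -ge0_mule_fsuml => [|y]; last exact: nnfun_muleindic_ge0.
  by rewrite fsumEFin // -(fimfunE _ (phi x)).
have mi r : measurable_fun [set: X] (fun x => (\1_(h n @^-1` [set r]) (phi x) : R)%:E).
  by apply/measurable_EFinP; apply: (measurableT_comp _ mphi); exact: measurable_indic.
rewrite ge0_integral_fsum//; last 2 first.
- move=> r; apply: emeasurable_funM => //.
  under eq_fun do rewrite EFinM.
  by apply: emeasurable_funM => //.
- by move=> m y Ey; rewrite mule_ge0 ?lee_fin// -lee_fin nnfun_muleindic_ge0.
apply: eq_fsbigr => r /[!inE] -[y _ hyr].
have r0 : (0 <= r)%R by rewrite -hyr.
under eq_integral do rewrite EFinM.
rewrite ge0_integralZl//; last by apply/measurable_EFinP; exact: measurable_indic.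
under [RHS]eq_integral do rewrite EFinM -muleA.
rewrite ge0_integralZl//; last 2 first.
- exact: emeasurable_funM.
- by move=> z _; rewrite mule_ge0 ?lee_fin.
congr (_ * _); rewrite integral_indic// setIT nuE//.
rewrite integral_mkcond; apply: eq_integral => x _.
by rewrite muleC epatch_indic.
Qed.

End density.

Lemma expR_sqr_ge (R : realType) (u : R) : `|u| <= expR (u ^+ 2).
Proof.
apply: le_trans (expR_ge1Dx _).
rewrite -(real_normK (num_real u)); have := sqr_ge0 (`|u| - 1); nra.
Qed.

Section gaussian.
Context {R : realType}.
Local Notation mu := (@lebesgue_measure R).
Variable s : R.
Hypothesis s0 : 0 < s.
Local Notation n := (normal_pdf 0 s).

Let nE x : n x = normal_peak s * expR (- x ^+ 2 / (s ^+ 2 *+ 2)).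
Proof. by rewrite normal_pdfE ?gt_eqF// /normal_fun subr0. Qed.

(** The exponent [x^2 / (2 s^2)] is split in half: one half absorbs [|x|] through [|u| <= exp(u^2)]
    with [u = x / (2 s)], the other is the exponent of a Gaussian of deviation [s sqrt 2]. *)
Lemma normr_normal_pdf_le x : `|x| * n x <=
  normal_peak s * (s * 2) * normal_fun 0 (s * Num.sqrt 2) x.
Proof.
rewrite nE /normal_fun subr0 mulrCA -!mulrA ler_wpM2l ?normal_peak_ge0//.
have -> : - x ^+ 2 / (s ^+ 2 *+ 2)
    = - (x / (s * 2)) ^+ 2 - x ^+ 2 / ((s * Num.sqrt 2) ^+ 2 *+ 2).
  by rewrite [(s * Num.sqrt 2) ^+ 2]exprMn sqr_sqrtr//; field; rewrite gt_eqF.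
rewrite expRD mulNr mulrA mulrA ler_wpM2r ?expR_ge0//.
rewrite expRN ler_pdivrMr ?expR_gt0//.
rewrite -ler_pdivrMl ?mulr_gt0// mulrC.
have := expR_sqr_ge (x / (s * 2)).
by rewrite normrM normrV ?unitfE ?mulf_neq0 ?gt_eqF// (gtr0_norm (mulr_gt0 _ _)).
Qed.

Lemma integrable_normr_normal_pdf : mu.-integrable setT
  (fun x => (`|x| * n x)%:E).
Proof.
have st0 : s * Num.sqrt 2 != 0 by rewrite mulf_neq0 ?gt_eqF// sqrtr_gt0.
apply: (@le_integrable _ _ _ mu _ _ _
  (fun x => ((normal_peak s * (s * 2) / normal_peak (s * Num.sqrt 2)) *
    normal_pdf 0 (s * Num.sqrt 2) x)%:E)) => //.
- apply/measurable_EFinP; apply: measurable_funM; last exact: measurable_normal_pdf.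
  exact: normr_measurable.
- move=> x _; rewrite !abse_EFin lee_fin.
  rewrite ger0_norm ?mulr_ge0 ?normal_pdf_ge0//.
  rewrite (le_trans (normr_normal_pdf_le x))// (le_trans _ (ler_norm _))//.
  rewrite normal_pdfE// -!mulrA ler_wpM2l ?normal_peak_ge0//.
  by rewrite mulKf ?gt_eqF ?normal_peak_gt0.
- under eq_fun do rewrite EFinM.
  by apply: integrableZl => //; exact: integrable_normal_pdf.
Qed.

Lemma integrable_bounded_normal_pdf (f : R -> R) :
  measurable_fun setT f -> (forall x, `|f x| <= 1) ->
  mu.-integrable setT (fun x => (f x * n x)%:E).
Proof.
move=> mf f1; apply: le_integrable (integrable_normal_pdf 0 s) => //.
- by apply/measurable_EFinP/measurable_funM => //; exact: measurable_normal_pdf.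
- move=> x _; rewrite !abse_EFin lee_fin normrM -[leRHS]mul1r.
  by rewrite ler_wpM2r.
Qed.

(** [|x| n(x)] is bounded, so [n] decays at least like [1 / (k + 1)] along the integers; this kills
    the boundary terms below. *)
Lemma cvg_normal_pdf_infty :
  (n k.+1%:R @[k --> \oo] --> 0) /\ (n (- k.+1%:R) @[k --> \oo] --> 0).
Proof.
have nN x : n (- x) = n x by rewrite !nE sqrrN.
under [in X in _ /\ X]eq_fun do rewrite nN.
suff : n k.+1%:R @[k --> \oo] --> 0 by [].
pose C := normal_peak s * (s * 2).
apply: (@squeeze_cvgr _ _ _ _ (cst 0) (fun k => C * harmonic k)).
- near=> k; rewrite normal_pdf_ge0/= ler_pdivlMr// mulrC.
  have := normr_normal_pdf_le k.+1%:R; rewrite ger0_norm// => /le_trans; apply.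
  rewrite /C ler_piMr//; first by rewrite !mulr_ge0 ?normal_peak_ge0// ltW.
  rewrite /normal_fun -[leRHS]expR0 ler_expR mulNr oppr_le0.
  by rewrite mulr_ge0 ?sqr_ge0// invr_ge0 mulrn_wge0// sqr_ge0.
- exact: cvg_cst.
- by rewrite -(mulr0 C); apply: cvgM; [exact: cvg_cst|exact: cvg_harmonic].
Unshelve. all: by end_near. Qed.

End gaussian.

Lemma is_derive_continuous (R : realType) (F f : R -> R) :
  (forall x : R, is_derive x 1 F (f x)) -> continuous F.
Proof.
move=> dF x; apply/differentiable_continuous/derivable1_diffP.
exact: ex_derive.
Qed.

(** The fundamental theorem on [[-(k+1), k+1]], then dominated convergence with majorant [|f|]. It
    reduces integration by parts on the line to exhibiting a primitive that vanishes at infinity. *)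
Lemma Rintegral_derive_eq0 (R : realType) (F f : R -> R) :
  (forall x : R, is_derive x 1 F (f x)) -> continuous f ->
  (@lebesgue_measure R).-integrable setT (EFin \o f) ->
  F k.+1%:R @[k --> \oo] --> 0 -> F (- k.+1%:R) @[k --> \oo] --> 0 ->
  \int[@lebesgue_measure R]_x f x = 0.
Proof.
move=> dF cf intf Fy FNy; set mu := @lebesgue_measure R.
have cF := is_derive_continuous dF.
pose A k : set R := `[- k.+1%:R, k.+1%:R]%classic.
have mA k : measurable (A k) by exact: measurable_itv.
have mf : measurable_fun setT f by exact: continuous_measurable_fun.
pose fn k x := (f \_ (A k) x)%:E.
have cvgI : (\int[mu]_x fn k x @[k --> \oo] --> \int[mu]_x (f x)%:E)%E.
  apply: (@dominated_cvg _ _ _ mu setT measurableT fn (EFin \o f)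
    (fun x => `|(f x)%:E|%E)) => //.
  - move=> k; apply/measurable_EFinP; apply: (measurable_restrictT f (mA k)).1.
    exact: measurable_funTS.
  - move=> x _; apply: (cvg_near_cst _); near=> k.
    rewrite /fn patchE ifT// inE /A/= in_itv/= -ler_norml.
    near: k; exists (Num.truncn `|x|) => // k /= xk.
    by rewrite (le_trans (ltW (truncnS_gt _)))// ler_nat.
  - exact: integrable_abse.
  - by move=> k x _; rewrite /fn patchE; case: ifP => // _; rewrite -[point]/(0 : R) abse0.
have IE k : (\int[mu]_x fn k x = (F k.+1%:R - F (- k.+1%:R))%:E)%E.
  have -> : fn k = (EFin \o f) \_ (A k) by rewrite restrict_EFin.
  rewrite -integral_mkcond (continuous_FTC2 (F := F))//.
  - by rewrite -subr_gt0 opprK addr_gt0 ?ltr0n.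
  - exact: continuous_subspaceT.
  - split => [x _||].
    + exact: ex_derive.
    + exact/cvg_at_right_filter/cF.
    + exact/cvg_at_left_filter/cF.
  - by move=> x _; rewrite derive1E; apply: derive_val.
have : (\int[mu]_x fn k x @[k --> \oo] --> 0)%E.
  under eq_fun do rewrite IE.
  apply: cvg_EFin; first exact: nearW.
  by rewrite -[X in _ --> X](subr0 0); exact: cvgB.
by move/(cvg_unique _ cvgI) => I0; rewrite /Rintegral I0.
Unshelve. all: by end_near. Qed.

Lemma normr_cos_le1 (R : realType) (x : R) : `|cos x| <= 1.
Proof. by rewrite ler_norml cos_geN1 cos_le1. Qed.

Lemma normr_sin_le1 (R : realType) (x : R) : `|sin x| <= 1.
Proof. by rewrite ler_norml sin_geN1 sin_le1. Qed.

Section gaussian_cos.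
Context {R : realType}.
Local Notation mu := (@lebesgue_measure R).
Variables s b : R.
Hypothesis s0 : 0 < s.
Local Notation n := (normal_pdf 0 s).

Lemma is_derive_normal_pdf (x : R) : is_derive x 1 n (- (x / s ^+ 2) * n x).
Proof.
have sn0 : s != 0 by rewrite gt_eqF.
have nE : n = (fun x => normal_peak s * expR (- x ^+ 2 / (s ^+ 2 *+ 2))).
  by rewrite normal_pdfE//; apply/funext => y; rewrite /normal_fun subr0.
rewrite nE.
have dg : is_derive x 1 (fun x => - x ^+ 2 / (s ^+ 2 *+ 2)) (- (x / s ^+ 2)).
  apply: is_derive_eq.
  by rewrite /GRing.scale/=; field.
apply: is_derive_eq.
by rewrite /GRing.scale/=; ring.
Qed.

Lemma is_derive_cos_affine (th x : R) :
  is_derive x 1 (fun x => cos (th * x + b)) (- (th * sin (th * x + b))).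
Proof. by apply: is_derive_eq; rewrite /GRing.scale/=; ring. Qed.

Lemma is_derive_sin_affine (th x : R) :
  is_derive x 1 (fun x => sin (th * x + b)) (th * cos (th * x + b)).
Proof. by apply: is_derive_eq; rewrite /GRing.scale/=; ring. Qed.

Let f th x := cos (th * x + b) * n x.
Let F th := \int[mu]_x f th x.
Let f' th x := - (x * sin (th * x + b) * n x).

Let continuous_f th : continuous (f th).
Proof.
move=> x; apply: (@cvgM _ _ _ _ (fun x => cos (th * x + b))).
  exact: is_derive_continuous (is_derive_cos_affine th) _.
exact: is_derive_continuous is_derive_normal_pdf _.
Qed.

Let continuous_f' th : continuous (f' th).
Proof.
move=> x; apply: (@cvgN _ R^o).
apply: (@cvgM _ _ _ _ (fun x => x * sin (th * x + b))).
  apply: (@cvgM _ _ _ _ id); first exact: cvg_id.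
  exact: is_derive_continuous (is_derive_sin_affine th) _.
exact: is_derive_continuous is_derive_normal_pdf _.
Qed.

Let measurable_f' th : measurable_fun setT (f' th).
Proof. exact: continuous_measurable_fun. Qed.

Let integrable_f th : mu.-integrable setT (EFin \o f th).
Proof.
apply: (@integrable_bounded_normal_pdf _ s (fun x => cos (th * x + b))).
  apply: continuous_measurable_fun.
  exact: is_derive_continuous (is_derive_cos_affine th).
by move=> x; rewrite normr_cos_le1.
Qed.

Let f'_le th x : `|f' th x| <= `|x| * n x.
Proof.
rewrite normrN normrM (ger0_norm (normal_pdf_ge0 _ _ _)).
by rewrite ler_wpM2r ?normal_pdf_ge0// normrM ler_piMr// normr_sin_le1.
Qed.

Let integrable_f' th : mu.-integrable setT (EFin \o f' th).
Proof.
apply: le_integrable (integrable_normr_normal_pdf s0) => //.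
  by apply/measurable_EFinP; exact: measurable_f'.
move=> x _; rewrite !abse_EFin lee_fin (le_trans (f'_le th x))//.
exact: ler_norm.
Qed.

(* Integrates the derivative of [s^2 sin(th x + b) n(x)]: this turns the
   differentiated integral into the equation [F' = - s^2 th F]. *)
Let integral_f' th : \int[mu]_x f' th x = - (s ^+ 2 * th * F th).
Proof.
pose H x := s ^+ 2 * (sin (th * x + b) * n x).
pose h x := s ^+ 2 * th * f th x + f' th x.
have dH (x : R) : is_derive x 1 H (h x).
  have dn := is_derive_normal_pdf x.
  have ds := is_derive_sin_affine th x.
  apply: is_derive_eq.
  by rewrite /h /f /f' /GRing.scale/=; field; rewrite gt_eqF.
have ithf : mu.-integrable setT (fun x => (s ^+ 2 * th * f th x)%:E).
  under eq_fun do rewrite EFinM.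
  by apply: integrableZl => //; exact: integrable_f.
have inth : mu.-integrable setT (EFin \o h).
  by apply: (@integrableD _ _ _ mu setT measurableT
    (fun x => (s ^+ 2 * th * f th x)%:E) (EFin \o f' th)).
have Hn x : `|H x| <= s ^+ 2 * n x.
  rewrite normrM (ger0_norm (sqr_ge0 _)) ler_wpM2l ?sqr_ge0//.
  rewrite normrM (ger0_norm (normal_pdf_ge0 _ _ _)).
  by rewrite -[leRHS]mul1r ler_wpM2r ?normal_pdf_ge0// normr_sin_le1.
have cvgH (u : nat -> R) : n (u k) @[k --> \oo] --> 0 -> H (u k) @[k --> \oo] --> 0.
  move=> nu; apply: norm_cvg0.
  apply: (@squeeze_cvgr _ _ _ _ (cst 0) (fun k => s ^+ 2 * n (u k))).
  - by apply: nearW => k; rewrite normr_ge0 Hn.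
  - exact: cvg_cst.
  - by rewrite -[X in _ --> X](mulr0 (s ^+ 2)); apply: cvgM => //; exact: cvg_cst.
have [n1 n2] := cvg_normal_pdf_infty s0.
have ch : continuous h.
  move=> x; apply: (@cvgD _ R^o); last exact: continuous_f'.
  by apply: (@cvgM _ _ _ _ (cst (s ^+ 2 * th))); [exact: cvg_cst|exact: continuous_f].
have := Rintegral_derive_eq0 dH ch inth (cvgH _ n1) (cvgH _ n2).
rewrite /h RintegralD//.
rewrite RintegralZl// -/(F th).
by move/eqP; rewrite addrC addr_eq0 => /eqP.
Qed.

Let is_derive_f (th x : R) : is_derive th 1 (f ^~ x) (f' th x).
Proof.
have dc : is_derive th 1 (fun th => cos (th * x + b)) (- (x * sin (th * x + b))).
  by apply: is_derive_eq; rewrite /GRing.scale/=; ring.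
apply: is_derive_eq.
by rewrite /f' /GRing.scale/=; ring.
Qed.

(** Differentiation under the integral: the majorant [|x| n(x)] is independent of [th], so the
    interval around [th] is arbitrary. *)
Let is_derive_F (th : R) : is_derive th 1 F (- (s ^+ 2 * th * F th)).
Proof.
have It : `]th - 1, th + 1[%classic th.
  by rewrite /= in_itv/= ltrBlDr ltrDl ltr01.
have d1 t x : partial1of2 f t x = f' t x.
  by rewrite partial1of2E; apply: derive_val.
have Gub t x : `]th - 1, th + 1[%classic t -> setT x ->
   `|partial1of2 f t x| <= `|x| * n x by rewrite d1.
have df t x : `]th - 1, th + 1[%classic t -> setT x -> derivable (f ^~ x) t 1.
  by move=> _ _; apply: ex_derive.
have G0 x : 0 <= `|x| * n x by rewrite mulr_ge0 ?normal_pdf_ge0.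
have intf t : `]th - 1, th + 1[%classic t -> mu.-integrable setT (EFin \o f t).
  by [].
have intG := integrable_normr_normal_pdf s0.
apply: DeriveDef.
  exact: (derivable_under_integral measurableT It intf df G0 intG Gub).
rewrite -derive1E.
rewrite (differentiation_under_integral measurableT It intf df G0 intG Gub).
by under eq_Rintegral do rewrite d1.
Qed.

(** The equation [F' = - s^2 th F] makes [F th * exp(s^2 th^2 / 2)] constant, and [F 0 = cos b]. The
    phase [b] stands in for complex exponentials: a shift by [pi / 2] turns cosines into sines. *)
Lemma Rintegral_cos_normal_pdf th :
  \int[mu]_x (cos (th * x + b) * n x) = cos b * expR (- (s ^+ 2 * th ^+ 2 / 2)).
Proof.
rewrite -/(F th).
pose E t := F t * expR (s ^+ 2 * t ^+ 2 / 2).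
have dE (t : R) : is_derive t 1 E 0.
  have dF := is_derive_F t.
  have de : is_derive t 1 (fun t => expR (s ^+ 2 * t ^+ 2 / 2))
      (s ^+ 2 * t * expR (s ^+ 2 * t ^+ 2 / 2)).
    by apply: is_derive_eq; rewrite /GRing.scale/=; field.
  by apply: is_derive_eq; rewrite /GRing.scale/=; ring.
have : E th = E 0 by apply: is_derive_0_is_cst.
rewrite /E expr0n mulr0 mul0r expR0 mulr1 => EF.
rewrite expRN -(_ : F 0 = cos b).
  by rewrite -EF mulfK// gt_eqF// expR_gt0.
rewrite /F /f; under eq_Rintegral do rewrite mul0r add0r.
rewrite RintegralZl//; last exact: integrable_normal_pdf.
by rewrite /Rintegral integral_normal_pdf mulr1.
Qed.

End gaussian_cos.

(** * Sums of independent Gaussian variables *)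

(** A class closed under sums, products and restriction to measurable sets, whose members are
    integrable for every probability; it settles nearly all integrability conditions below. *)
Definition bounded_measurable d (T : measurableType d) (R : realType) (f : T -> R) :=
  measurable_fun [set: T] f /\ exists M, forall x, `|f x| <= M.

Section bounded_measurable.
Context d (T : measurableType d) (R : realType) (P : probability T R).
Implicit Types f g : T -> R.

Lemma bounded_measurable_cst (r : R) : bounded_measurable (fun _ : T => r).
Proof. by split; [exact: measurable_cst|exists `|r|]. Qed.

Lemma bounded_measurableD f g : bounded_measurable f -> bounded_measurable g ->
  bounded_measurable (fun x => f x + g x).
Proof.
move=> [mf [M fM]] [mg [N gN]]; split; first exact: measurable_funD.
by exists (M + N) => x; rewrite (le_trans (ler_normD _ _))// lerD.
Qed.

Lemma bounded_measurableM f g : bounded_measurable f -> bounded_measurable g ->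
  bounded_measurable (fun x => f x * g x).
Proof.
move=> [mf [M fM]] [mg [N gN]]; split; first exact: measurable_funM.
by exists (M * N) => x; rewrite normrM ler_pM.
Qed.

Lemma bounded_measurable_cos f : measurable_fun setT f ->
  bounded_measurable (fun x => cos (f x)).
Proof.
move=> mf; split; last by exists 1 => x; exact: normr_cos_le1.
apply: (measurableT_comp _ mf); apply: continuous_measurable_fun.
exact: continuous_cos.
Qed.

Lemma bounded_measurable_sum I (r : seq I) (f : I -> T -> R) :
  (forall i, bounded_measurable (f i)) ->
  bounded_measurable (fun x => \sum_(i <- r) f i x).
Proof.
move=> bf; elim: r => [|i r IH].
  by under eq_fun do rewrite big_nil; exact: bounded_measurable_cst.
by under eq_fun do rewrite big_cons; exact: bounded_measurableD.
Qed.

Lemma bounded_measurable_patch f D : measurable D ->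
  bounded_measurable f -> bounded_measurable (f \_ D).
Proof.
move=> mD [mf [M fM]]; split.
  by apply: (measurable_restrictT f mD).1; exact: measurable_funTS.
exists M => x; rewrite patchE; case: ifP => // _.
by rewrite -[point]/(0 : R) normr0 (le_trans _ (fM x)).
Qed.

Lemma bounded_measurable_integrable f D : measurable D ->
  bounded_measurable f -> P.-integrable D (EFin \o f).
Proof.
move=> mD [mf [M fM]].
apply: measurable_bounded_integrable => //.
- exact: le_lt_trans (probability_le1 P mD) (ltry _).
- exact: measurable_funTS.
- exists M; split; first by rewrite num_real.
  by move=> y My x _ /=; rewrite (le_trans (fM x))// ltW.
Qed.

Lemma bRintegralD f g : bounded_measurable f -> bounded_measurable g ->
  \int[P]_x (f x + g x) = \int[P]_x f x + \int[P]_x g x.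
Proof.
by move=> bf bg; rewrite RintegralD//; exact: bounded_measurable_integrable.
Qed.

Lemma bRintegralZ f (k : R) : bounded_measurable f ->
  \int[P]_x (k * f x) = k * \int[P]_x f x.
Proof.
by move=> bf; rewrite RintegralZl//; exact: bounded_measurable_integrable.
Qed.

Lemma bRintegral_sum I (r : seq I) (f : I -> T -> R) :
  (forall i, bounded_measurable (f i)) ->
  \int[P]_x (\sum_(i <- r) f i x) = \sum_(i <- r) \int[P]_x f i x.
Proof.
move=> bf; elim: r => [|i r IH].
  rewrite big_nil; under eq_Rintegral do rewrite big_nil.
  by rewrite Rintegral_cst// mul0r.
under eq_Rintegral do rewrite big_cons.
by rewrite bRintegralD ?IH ?big_cons//; exact: bounded_measurable_sum.
Qed.

Lemma Rintegral_probability_cst (r : R) : \int[P]_x r = r.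
Proof.
rewrite Rintegral_cst// -[RHS]mulr1; congr (_ * _).
by transitivity (fine (1%E : \bar R)); first by congr fine; exact: probability_setT.
Qed.

End bounded_measurable.

Section independent_gaussian.
Context d (T : measurableType d) (R : realType) (P : probability T R).
Variables (xi : T -> R) (s : R).
Hypotheses (mxi : measurable_fun [set: T] xi) (s0 : 0 < s).
Local Notation N := (normal_prob 0 s).

(** The hypothesis says that [P] weighted by [p] has, under [xi], the image [N] times the mass of
    [p]. The integrand is [1 + cos] because [ge0_integral_density] wants it non-negative. *)
Let Rintegral_indep_cos_ge0 (p : T -> R) (th b : R) :
  bounded_measurable p -> (forall x, 0 <= p x) ->
  (forall B, measurable B ->
    \int[P]_(x in xi @^-1` B) p x = \int[P]_x p x * fine (N B)) ->
  \int[P]_x (p x * (1 + cos (th * xi x + b))) =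
  \int[P]_x p x * (1 + cos b * expR (- (s ^+ 2 * th ^+ 2 / 2))).
Proof.
move=> bp p0 indep; have [mp _] := bp.
have Ip0 : 0 <= \int[P]_x p x by apply: Rintegral_ge0.
pose g y := 1 + cos (th * y + b).
have g0 y : 0 <= g y by rewrite -lerBlDl sub0r cos_geN1.
have mcos : measurable_fun [set: R] (fun y => cos (th * y + b)).
  by apply: continuous_measurable_fun; exact: is_derive_continuous (is_derive_cos_affine b th).
have mg : measurable_fun [set: R] (EFin \o g).
  by apply/measurable_EFinP; exact: measurable_funD.
have intp D : measurable D -> P.-integrable D (EFin \o p).
  by move=> mD; exact: bounded_measurable_integrable.
have nuE B : measurable B ->
    mscale (NngNum Ip0) N B = (\int[P]_(x in xi @^-1` B) (p x)%:E)%E.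
  move=> mB; have mxB : measurable (xi @^-1` B).
    by rewrite -[X in measurable X]setTI; exact: mxi.
  rewrite -[RHS]fineK; last exact/integrable_fin_num/intp.
  rewrite -/(Rintegral _ _ _) indep// EFinM /mscale/=; congr (_ * _)%E.
  by rewrite [RHS]fineK// fin_num_measure.
have Eg0 (y : R) : (0 <= (g y)%:E)%E by rewrite lee_fin.
have := @ge0_integral_density d _ T (measurableTypeR R) R P (mscale (NngNum Ip0) N)
  xi p mxi mp p0 nuE (EFin \o g) mg Eg0.
rewrite ge0_integral_mscale//=.
have NE B : measurable B ->
    N B = (\int[@lebesgue_measure R]_(x in id @^-1` B) (normal_pdf 0 s x)%:E)%E.
  by move=> mB.
have npdf0 x : 0 <= normal_pdf 0 s x by exact: normal_pdf_ge0.
rewrite (@ge0_integral_density _ _ (measurableTypeR R) (measurableTypeR R) R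
  lebesgue_measure N id (normal_pdf 0 s) (@measurable_id _ _ _)
  (measurable_normal_pdf 0 s) npdf0 NE (EFin \o g) mg Eg0)/=.
move=> /(congr1 fine).
set I := (\int[lebesgue_measure]_x _)%E.
have -> : I = (1 + cos b * expR (- (s ^+ 2 * th ^+ 2 / 2)))%:E.
  rewrite -Rintegral_cos_normal_pdf//.
  have i1 := integrable_normal_pdf 0 s.
  have i2 := @integrable_bounded_normal_pdf R s _ mcos (fun=> normr_cos_le1 _).
  rewrite /I; under eq_integral do rewrite -EFinM mulrDl mul1r EFinD.
  rewrite integralD// integral_normal_pdf EFinD fineK//.
  exact: integrable_fin_num.
rewrite -EFinM/= => ->; rewrite {1}/Rintegral; congr fine.
by apply: eq_integral => x _; rewrite -EFinM mulrC.
Qed.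

Hypothesis lawxi : forall B, measurable B -> P (xi @^-1` B) = N B.

(** Signs are removed by shifts: the non-negative case is applied to [F + M], where [|F| <= M], and
    to the constant [M]. Subtraction leaves [F] against [1 + cos], from which the contribution of
    [1] is cancelled. *)
Lemma Rintegral_indep_cos (F : T -> R) (th b : R) : bounded_measurable F ->
  (forall B, measurable B ->
    \int[P]_(x in xi @^-1` B) F x = \int[P]_x F x * fine (N B)) ->
  \int[P]_x (F x * cos (th * xi x + b)) =
  \int[P]_x F x * (cos b * expR (- (s ^+ 2 * th ^+ 2 / 2))).
Proof.
move=> bF indep; have [mF [M FM]] := bF.
have mxB B : measurable B -> measurable (xi @^-1` B).
  by move=> mB; rewrite -[X in measurable X]setTI; exact: mxi.
have bM (r : R) := @bounded_measurable_cst _ T _ r.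
have bFM := bounded_measurableD bF (bM M).
have bc : bounded_measurable (fun x => cos (th * xi x + b)).
  apply: bounded_measurable_cos; apply: measurable_funD => //.
  exact: measurable_funM.
have cstI B : measurable B -> \int[P]_(x in xi @^-1` B) M = M * fine (N B).
  move=> mB; rewrite Rintegral_cst; last exact: mxB.
  by congr (_ * fine _); exact: lawxi.
have M0 (x : T) : 0 <= M by rewrite (le_trans _ (FM x)).
have h1 := @Rintegral_indep_cos_ge0 (fun x => F x + M) th b bFM _ _.
have h2 := @Rintegral_indep_cos_ge0 (fun x => M) th b (bM M) M0 _.
have {}h1 : \int[P]_x ((F x + M) * (1 + cos (th * xi x + b))) =
    (\int[P]_x F x + M) * (1 + cos b * expR (- (s ^+ 2 * th ^+ 2 / 2))).
  rewrite h1.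
  - by rewrite bRintegralD// Rintegral_probability_cst.
  - by move=> x; rewrite -lerBlDr sub0r lerNl; have /ler_normlP[] := FM x.
  - move=> B mB; rewrite bRintegralD// Rintegral_probability_cst mulrDl -indep//.
    rewrite -cstI// RintegralD//; try exact: mxB.
      exact: bounded_measurable_integrable (mxB _ mB) bF.
    exact: bounded_measurable_integrable (mxB _ mB) (bM M).
have {}h2 : \int[P]_x (M * (1 + cos (th * xi x + b))) =
    M * (1 + cos b * expR (- (s ^+ 2 * th ^+ 2 / 2))).
  by rewrite h2 Rintegral_probability_cst// => B mB; rewrite cstI// Rintegral_probability_cst.
have h3 : \int[P]_x (F x * (1 + cos (th * xi x + b))) =
    \int[P]_x F x * (1 + cos b * expR (- (s ^+ 2 * th ^+ 2 / 2))).
  have b1 : bounded_measurable (fun x => 1 + cos (th * xi x + b)).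
    exact: bounded_measurableD.
  move: h1; under eq_Rintegral do rewrite mulrDl.
  rewrite bRintegralD ?h2; [|exact: bounded_measurableM..].
  by rewrite [in RHS]mulrDl => /addIr.
move: h3; under eq_Rintegral do rewrite mulrDr mulr1.
rewrite bRintegralD//; last exact: bounded_measurableM.
by rewrite [in RHS]mulrDr mulr1 => /addrI.
Qed.

End independent_gaussian.

Section gaussian_sum.
Context d (T : measurableType d) (R : realType) (P : probability T R).
Variables (m : nat) (xi : nat -> T -> R) (s : R).
Hypotheses (mxi : forall k, measurable_fun [set: T] (xi k)) (s0 : 0 < s).
Local Notation N := (normal_prob 0 s).
Hypothesis lawxi : forall k B, (k < m)%N -> measurable B ->
  P (xi k @^-1` B) = N B.
Hypothesis indepxi : forall B : nat -> set R, (forall k, measurable (B k)) ->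
  P [set om | forall k, (k < m)%N -> B k (xi k om)]
  = (\prod_(k < m) P (xi k @^-1` B k))%E.
Variable th : nat -> R.

(* The induction of [Rintegral_tail] carries events on the increments not yet
   summed, which is what makes the next increment independent. *)
Let tail n (B : nat -> set R) :=
  [set om | forall k, (n <= k < m)%N -> B k (xi k om)].
Let S n x := \sum_(k < n) th k * xi k x.
Let Q n := expR (- (s ^+ 2 / 2 * \sum_(k < n) th k ^+ 2)).

Let measurable_S n : measurable_fun setT (S n).
Proof.
rewrite /S; elim: n => [|n IH].
  by under eq_fun do rewrite big_ord0; exact: measurable_cst.
under eq_fun do rewrite big_ord_recr/=.
by apply: measurable_funD => //; exact: measurable_funM.
Qed.

Let measurable_xi k B : measurable B -> measurable (xi k @^-1` B).
Proof. by move=> mB; rewrite -[X in measurable X]setTI; exact: mxi. Qed.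

Let tail_recl n B : (n < m)%N -> tail n B = xi n @^-1` B n `&` tail n.+1 B.
Proof.
move=> nm; apply/seteqP; split => x /=.
  move=> xB; split; first by apply: xB; rewrite leqnn.
  by move=> k /andP[nk km]; apply: xB; rewrite ltnW.
move=> [xn xB] k /andP[]; rewrite leq_eqVlt => /predU1P[<-//|nk km].
by apply: xB; rewrite nk.
Qed.

Let measurable_tail n B : (forall k, measurable (B k)) -> measurable (tail n B).
Proof.
move=> mB; rewrite (_ : tail n B =
    \bigcap_k (if (n <= k < m)%N then xi k @^-1` B k else setT)).
  by apply: bigcapT_measurable => k; case: ifP => // _; exact: measurable_xi.
apply/seteqP; split => x /= h k; last by move=> nkm; have := h k I; rewrite /= nkm.
by move=> _; case: ifP => // nkm; exact: h.
Qed.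

Let Rintegral_tail n : (n <= m)%N -> forall (B : nat -> set R) (b : R),
  (forall k, measurable (B k)) ->
  \int[P]_(x in tail n B) cos (b + S n x)
  = cos b * Q n * \prod_(n <= k < m) fine (N (B k)).
Proof.
elim: n => [_|n IH nm] B b mB.
  have PB : P (tail 0 B) = (\prod_(0 <= k < m) fine (N (B k)))%:E.
    rewrite (_ : tail 0 B = [set om | forall k, (k < m)%N -> B k (xi k om)])//.
    rewrite indepxi// big_mkord -prodEFin; apply: eq_bigr => k _.
    rewrite fineK; first exact: lawxi.
    by apply: fin_num_measure; exact: mB.
  rewrite /Q /S big_ord0 mulr0 oppr0 expR0 mulr1.
  under eq_Rintegral do rewrite big_ord0 addr0.
  rewrite Rintegral_cst; last exact: measurable_tail.
  by congr (_ * _); rewrite -[RHS]/(fine (_%:E)) -PB.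
have bcos b' : bounded_measurable (fun x => cos (b' + S n x)).
  by apply: bounded_measurable_cos; exact: measurable_funD.
have mtail := measurable_tail n.+1 mB.
pose F b' := (fun x => cos (b' + S n x)) \_ (tail n.+1 B).
have bF b' : bounded_measurable (F b') by exact: bounded_measurable_patch.
(* Putting an arbitrary [B0] in place of the [n]-th event of the induction hypothesis gives the
   product formula that [Rintegral_indep_cos] asks of [F b'] and [xi n]. *)
have FI b' B0 : measurable B0 -> \int[P]_(x in xi n @^-1` B0) F b' x =
    cos b' * Q n * (\prod_(n.+1 <= k < m) fine (N (B k))) * fine (N B0).
  move=> mB0; rewrite -Rintegral_mkcondr.
  pose B' k := if k == n then B0 else B k.
  have mB' k : measurable (B' k) by rewrite /B'; case: ifP.
  have -> : xi n @^-1` B0 `&` tail n.+1 B = tail n B'.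
    rewrite [RHS]tail_recl// {1}/B' eqxx; congr (_ `&` _).
    have BB' k : (n < k)%N -> B' k = B k by move=> nk; rewrite /B' gtn_eqF.
    by apply/seteqP; split => x /= h k nkm; have := h k nkm;
      rewrite BB'//; case/andP: nkm.
  rewrite (IH (ltnW nm))// (big_ltn nm) -!mulrA; congr (_ * (_ * _)).
  rewrite mulrC; congr (_ * _); last by rewrite /B' eqxx.
  by apply: eq_big_nat => k /andP[nk _]; rewrite /B' gtn_eqF.
have FE b' : \int[P]_x F b' x =
    cos b' * Q n * \prod_(n.+1 <= k < m) fine (N (B k)).
  rewrite -[in LHS](preimage_setT (xi n)) FI// -[RHS]mulr1; congr (_ * _).
  by transitivity (fine (1%E : \bar R)); first by congr fine; exact: probability_setT.
have FC b' b'' := Rintegral_indep_cos (mxi n) s0 (fun B mB => lawxi nm mB) (th n)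
  b'' (bF b') (fun B0 mB0 => etrans (FI b' B0 mB0) (esym (congr1 (fun u => u * _) (FE b')))).
have bxi b' : bounded_measurable (fun x => cos (th n * xi n x + b')).
  apply: bounded_measurable_cos; apply: measurable_funD => //.
  exact: measurable_funM.
(* The addition formula, each sine being a cosine of phase [- pi / 2]. The product of sines
   integrates to 0 because [cos (- (pi / 2)) = 0]. *)
transitivity (\int[P]_x (F b x * cos (th n * xi n x + 0)
    + (- 1) * (F (b - pi / 2) x * cos (th n * xi n x + - (pi / 2))))).
  rewrite Rintegral_mkcond; apply: eq_Rintegral => x _.
  rewrite /F !patchE; case: ifP => _; last first.
    by rewrite -[point]/(0 : R); ring.
  rewrite /S big_ord_recr/= -/(S n x) addr0.
  have cosBpihalf y : cos (y - pi / 2) = sin y.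
    by rewrite cosB cos_pihalf sin_pihalf mulr0 mulr1 add0r.
  by rewrite -[b - _ + _]addrAC !cosBpihalf addrA cosD; ring.
rewrite bRintegralD; [|exact: bounded_measurableM|]; last first.
  by apply: bounded_measurableM; [exact: bounded_measurable_cst|exact: bounded_measurableM].
rewrite bRintegralZ; last exact: bounded_measurableM.
rewrite !FC !FE cosN cos_pihalf cos0 mul0r mulr0 mulr0 addr0 mul1r.
rewrite {2}/Q big_ord_recr/= mulrDr opprD expRD -/(Q n).
by rewrite (mulrAC (s ^+ 2)); ring.
Qed.

Lemma Rintegral_cos_gaussian_sum b :
  \int[P]_x cos (b + \sum_(k < m) th k * xi k x)
  = cos b * expR (- (s ^+ 2 / 2 * \sum_(k < m) th k ^+ 2)).
Proof.
have := Rintegral_tail (leqnn m) b (fun k : nat => @measurableT _ R).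
rewrite big_geq// mulr1 => <-; congr Rintegral.
by apply/seteqP.
Qed.

End gaussian_sum.

(** * Second and fourth moments of the cosine sums *)

(** Subtraction is truncated, so one of the terms is 0 and this is [|a - b|]. *)
Definition natdist (a b : nat) : nat := (a - b + (b - a))%N.

Lemma natdist_triangle b a c : (natdist a c <= natdist a b + natdist b c)%N.
Proof. by rewrite /natdist; lia. Qed.

(* The sum counts the [j] lying above an odd number of [a, b, c, d].  Those
   form the two outer gaps once the four numbers are sorted, and this is the
   left-hand side for one of the three pairings. *)
Lemma parity_sum_ge m a b c d : (a <= m -> b <= m -> c <= m -> d <= m ->
  minn (minn (natdist a b + natdist c d) (natdist a c + natdist b d))
       (natdist a d + natdist b c)
  <= \sum_(j < m) ((a <= j) (+) (b <= j) (+) (c <= j) (+) (d <= j)))%N.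
Proof.
move=> am bm cm dm.
(* Induction on a truncation level: from [n] to [n + 1] a truncated distance grows by 1 exactly when
   one of the two numbers is at most [n] and the other is not. *)
pose D n x y := natdist (minn x n) (minn y n).
suff H n : (minn (minn (D n a b + D n c d) (D n a c + D n b d)) (D n a d + D n b c)
  <= \sum_(j < n) ((a <= j) (+) (b <= j) (+) (c <= j) (+) (d <= j)))%N.
  have := H m; rewrite /D.
  by rewrite (minn_idPl am) (minn_idPl bm) (minn_idPl cm) (minn_idPl dm).
elim: n => [|n IH]; first by rewrite /D !minn0.
rewrite big_ord_recr/=; apply: leq_trans (leq_add IH (leqnn _)); move: IH => _.
have DS x y : (D n.+1 x y <= D n x y + ((x <= n) (+) (y <= n)))%N.
  rewrite /D /natdist.
  by case: (leqP x n) => xn; case: (leqP y n) => yn /=; lia.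
have D0 x y : (n < x)%N -> (n < y)%N -> D n x y = 0%N.
  by move=> nx ny; rewrite /D /natdist; lia.
(* When exactly two numbers are at most [n], the right-hand side stays put but two pairings grow.
   The third joins small with small and large with large; both large numbers being truncated to [n],
   it is already the least by the triangle inequality. *)
have D4 x y z t : (D n z t <= D n z x + D n x y + D n y t)%N.
  rewrite /D; apply: leq_trans (natdist_triangle (minn y n) _ _) _.
  by rewrite leq_add2r natdist_triangle.
have DC x y : D n x y = D n y x by rewrite /D /natdist addnC.
move: (DS a b) (DS a c) (DS a d) (DS b c) (DS b d) (DS c d).
move: (D4 a b c d) (D4 a b d c) (D4 a c b d) (D4 a c d b) (D4 a d b c) (D4 a d c b).
move: (D4 b c a d) (D4 b c d a) (D4 b d a c) (D4 b d c a) (D4 c d a b) (D4 c d b a).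
move: (D0 a b) (D0 a c) (D0 a d) (D0 b c) (D0 b d) (D0 c d).
rewrite (DC b a) (DC c a) (DC d a) (DC c b) (DC d b) (DC d c).
move: (D n a b) (D n a c) (D n a d) (D n b c) (D n b d) (D n c d).
move: (D n.+1 a b) (D n.+1 a c) (D n.+1 a d) (D n.+1 b c) (D n.+1 b d) (D n.+1 c d).
case: (leqP a n) => _; case: (leqP b n) => _; case: (leqP c n) => _;
  case: (leqP d n) => _ /= *; try lia.
Qed.

(** * Geometric sums over a square grid *)

Section geometric.
Context {R : realType} (q : R).
Hypothesis q01 : 0 <= q < 1.

Lemma sum_geometric_up m a :
  \sum_(b < m | (a <= b)%N) q ^+ (b - a) = (1 - q ^+ (m - a)) / (1 - q).
Proof.
have q1 : 1 - q != 0 by rewrite subr_eq0 gt_eqF//; case/andP: q01.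
elim: m => [|m IH]; first by rewrite big_ord0 sub0n expr0 subrr mul0r.
rewrite big_mkcond big_ord_recr/= -big_mkcond/= IH.
case: leqP => am; last by rewrite addr0 (eqP (ltnW am)) (eqP am).
by rewrite subSn// exprS; field.
Qed.

Lemma sum_geometric_down m a :
  \sum_(b < m | (b <= a)%N) q ^+ (a - b) = (q ^+ (a.+1 - m) - q ^+ a.+1) / (1 - q).
Proof.
have q1 : 1 - q != 0 by rewrite subr_eq0 gt_eqF//; case/andP: q01.
elim: m => [|m IH]; first by rewrite big_ord0 subn0 subrr mul0r.
rewrite big_mkcond big_ord_recr/= -big_mkcond/= IH subSS.
case: leqP => am; last by rewrite addr0 (eqP (ltnW am)) (eqP am).
by rewrite subSn// !exprS; field.
Qed.

(** Each row is at most two geometric series, one on either side of the diagonal, with the diagonal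
    term counted twice. *)
Lemma sum_natdist_le m : \sum_(a < m) \sum_(b < m) q ^+ natdist a b
  <= m%:R * (2 / (1 - q)).
Proof.
have /andP[q0 q1] := q01.
have q1' : 0 < 1 - q by rewrite subr_gt0.
rewrite -[X in X%:R * _]card_ord mulr_natl -sumr_const; apply: ler_sum => a _.
have e1 k : q ^+ k <= 1 by rewrite exprn_ile1// ltW.
have e0 k : 0 <= q ^+ k by rewrite exprn_ge0.
apply: (@le_trans _ _ (\sum_(b < m | (a <= b)%N) q ^+ (b - a)
    + \sum_(b < m | (b <= a)%N) q ^+ (a - b))).
  rewrite [X in _ <= X + _]big_mkcond [X in _ <= _ + X]big_mkcond -big_split/=; apply: ler_sum => b _.
  rewrite /natdist; case: (leqP a b) => ab; case: (leqP b a) => ba.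
  - have -> : nat_of_ord a = b by lia.
    by rewrite subnn expr0; lra.
  - by rewrite (eqP (ltnW ba)) add0n addr0.
  - by rewrite (eqP (ltnW ab)) addn0 add0r.
  - by lia.
rewrite sum_geometric_up sum_geometric_down -mulrDl ler_pM2r ?invr_gt0//.
have := e0 (m - a)%N; have := e1 (a.+1 - m)%N; have := e0 a.+1; lra.
Qed.

(** Only the rows [a < n] are kept, and in them the columns [b >= a], of which there are more than
    [n]. This is why all grids have an even number of points. *)
Lemma sum_natdist_ge n :
  n%:R * ((1 - q ^+ n) / (1 - q))
  <= \sum_(a < n.*2) \sum_(b < n.*2) q ^+ natdist a b.
Proof.
have /andP[q0 q1] := q01.
have q1' : 0 < 1 - q by rewrite subr_gt0.
have e0 k : 0 <= q ^+ k by rewrite exprn_ge0.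
rewrite -addnn big_split_ord/= -[leLHS]addr0 lerD//; last first.
  by apply: sumr_ge0 => a _; apply: sumr_ge0.
rewrite -[X in X%:R * _]card_ord mulr_natl -sumr_const; apply: ler_sum => a _.
rewrite (bigID (fun b : 'I_(n + n) => (a <= b)%N))/= -[leLHS]addr0 lerD//; last first.
  exact: sumr_ge0.
rewrite (eq_bigr (fun b : 'I_(n + n) => q ^+ (b - a))); last first.
  by move=> b ab; rewrite /natdist (eqP ab) add0n.
rewrite sum_geometric_up ler_pM2r ?invr_gt0// lerB//.
rewrite ler_wiXn2l//; first exact: ltW.
by have := ltn_ord a; lia.
Qed.

End geometric.

(** From index [m] on only measurability is asked. Subfamilies are covered by letting some [B k] be
    the whole line. *)
Definition iid_gaussian d (T : measurableType d) (R : realType)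
    (P : probability T R) (m : nat) (s : R) (xi : nat -> T -> R) : Prop :=
  [/\ (forall k, measurable_fun [set: T] (xi k)),
      (forall k B, (k < m)%N -> measurable B ->
        P (xi k @^-1` B) = normal_prob 0 s B)
    & (forall B : nat -> set R, (forall k, measurable (B k)) ->
        P [set om | forall k, (k < m)%N -> B k (xi k om)]
        = (\prod_(k < m) P (xi k @^-1` B k))%E)].

Section walk_moments.
Context d (T : measurableType d) (R : realType) (P : probability T R).
Variables (m : nat) (s kap : R) (xi : nat -> T -> R).
Hypotheses (s0 : 0 < s) (iid : iid_gaussian P m s xi).

(** The discrete [kap (w_t - w_s)], with [s] the [a]-th grid point. The cut-off is a 0/1
    coefficient, so that any combination of walks is again a weighted sum over all [j < m]. *)
Definition tail_walk (a : nat) (x : T) : R :=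
  \sum_(j < m) (kap * (a <= j)%N%:R) * xi j x.
Local Notation W := tail_walk.

Let q : R := expR (- (s ^+ 2 / 2 * kap ^+ 2)).

Let qX k : q ^+ k = expR (- (s ^+ 2 / 2 * (kap ^+ 2 * k%:R))).
Proof. by rewrite -expRM_natl; congr expR; ring. Qed.

Lemma measurable_tail_walk a : measurable_fun [set: T] (W a).
Proof.
have [mxi _ _] := iid.
rewrite /tail_walk; move: (index_enum _) => r; elim: r => [|i r IH].
  by under eq_fun do rewrite big_nil; exact: measurable_cst.
under eq_fun do rewrite big_cons.
by apply: measurable_funD => //; exact: measurable_funM.
Qed.

Let bcosW a b : bounded_measurable (fun x => cos (b + W a x)).
Proof.
by apply: bounded_measurable_cos; apply: measurable_funD => //; exact: measurable_tail_walk.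
Qed.

Lemma Rintegral_cos_tail_walk a b : (a <= m)%N ->
  \int[P]_x cos (b + W a x) = cos b * q ^+ (m - a).
Proof.
have [mxi lawxi indep] := iid.
move=> am.
apply: (etrans (Rintegral_cos_gaussian_sum mxi s0 lawxi indep
  (fun j => kap * (a <= j)%N%:R) b)).
congr (_ * _); rewrite qX; congr (expR (- (_ * _))).
under eq_bigr do rewrite exprMn -natrX.
rewrite -mulr_sumr; congr (_ * _).
rewrite -natr_sum; congr _%:R.
elim: m am => [|n IH]; first by rewrite leqn0 => /eqP ->; rewrite big_ord0.
rewrite big_ord_recr/= leq_eqVlt => /predU1P[->|].
  rewrite subnn ltnn big1// => i _; by rewrite leqNgt ltnS ltnW.
by rewrite ltnS => an; rewrite IH// an subSn// addn1.
Qed.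

Let Rintegral_cos_walkB a b : (a <= m)%N -> (b <= m)%N ->
  \int[P]_x cos (W a x - W b x) = q ^+ natdist a b.
Proof.
have [mxi lawxi indep] := iid.
move=> am bm.
pose th j : R := kap * ((a <= j)%N%:R - (b <= j)%N%:R).
under eq_Rintegral => x _.
  rewrite (_ : _ - _ = 0 + \sum_(j < m) th j * xi j x); last first.
    rewrite add0r /tail_walk -sumrB; apply: eq_bigr => j _.
    by rewrite /th; ring.
  over.
rewrite (Rintegral_cos_gaussian_sum mxi s0 lawxi indep th) cos0 mul1r qX.
congr (expR (- (_ * _))).
have thE j : th j ^+ 2 = kap ^+ 2 * ((a <= j)%N (+) (b <= j)%N)%:R.
  by rewrite /th; case: (a <= j)%N; case: (b <= j)%N => /=; ring.
under eq_bigr do rewrite thE.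
rewrite -mulr_sumr; congr (_ * _).
rewrite -natr_sum; congr _%:R.
have H n : (\sum_(j < n) ((a <= j) (+) (b <= j)) = natdist (minn a n) (minn b n))%N.
  elim: n => [|n IH]; first by rewrite big_ord0 !minn0.
  rewrite big_ord_recr/= IH /natdist.
  by case: (leqP a n) => an; case: (leqP b n) => bn /=; lia.
by rewrite H (minn_idPl am) (minn_idPl bm).
Qed.

(** A centred Gaussian has a positive characteristic function; lower bounds may thus drop the
    [cos (A + B)] half of the formula for [cos A cos B]. *)
Let Rintegral_cos_walkD_ge0 a b : 0 <= \int[P]_x cos (W a x + W b x).
Proof.
have [mxi lawxi indep] := iid.
pose th j : R := kap * ((a <= j)%N%:R + (b <= j)%N%:R).
under eq_Rintegral => x _.
  rewrite (_ : _ + _ = 0 + \sum_(j < m) th j * xi j x); last first.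
    rewrite add0r /tail_walk -big_split; apply: eq_bigr => j _.
    by rewrite /th/=; ring.
  over.
by rewrite (Rintegral_cos_gaussian_sum mxi s0 lawxi indep th) cos0 mul1r expR_ge0.
Qed.

(** The three pairings of four times. Their sum is taken, rather than their maximum, because each
    term factorises in the quadruple sum. *)
Let pairings a b c e : R := q ^+ (natdist a b + natdist c e)
  + q ^+ (natdist a c + natdist b e) + q ^+ (natdist a e + natdist b c).

(** Whatever the signs, an increment that occurs in an odd number of the four walks has a
    coefficient of modulus at least [|kap|]. By [parity_sum_ge] such increments are at least as many
    as the cost of the cheapest pairing, and [q] to that cost is one of the three terms. *)
Let Rintegral_cos_walk4_le a b c e (e1 e2 e3 : bool) :
  (a <= m)%N -> (b <= m)%N -> (c <= m)%N -> (e <= m)%N ->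
  \int[P]_x cos (W a x + (- 1) ^+ e1 * W b x + (- 1) ^+ e2 * W c x
    + (- 1) ^+ e3 * W e x) <= pairings a b c e.
Proof.
have [mxi lawxi indep] := iid.
move=> am bm cm em.
pose th j : R := kap * ((a <= j)%N%:R + (- 1) ^+ e1 * (b <= j)%N%:R
  + (- 1) ^+ e2 * (c <= j)%N%:R + (- 1) ^+ e3 * (e <= j)%N%:R).
under eq_Rintegral => x _.
  rewrite (_ : _ + _ = 0 + \sum_(j < m) th j * xi j x); last first.
    rewrite add0r /tail_walk !mulr_sumr -!big_split; apply: eq_bigr => j _.
    by rewrite /th/=; ring.
  over.
rewrite (Rintegral_cos_gaussian_sum mxi s0 lawxi indep th) cos0 mul1r.
pose par j := (a <= j)%N (+) (b <= j)%N (+) (c <= j)%N (+) (e <= j)%N.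
have thE j : kap ^+ 2 * (par j)%:R <= th j ^+ 2.
  rewrite /th exprMn ler_wpM2l ?sqr_ge0// /par.
  (* An odd number of signs cannot sum to 0. *)
  have sg (i : bool) : (- 1) ^+ i = 1 :> R \/ (- 1) ^+ i = - 1 :> R.
    by case: i; [right; rewrite expr1|left; rewrite expr0].
  case: (sg e1) => ->; case: (sg e2) => ->; case: (sg e3) => ->;
  by case: (a <= j)%N; case: (b <= j)%N; case: (c <= j)%N; case: (e <= j)%N => /=; lra.
apply: (@le_trans _ _ (q ^+ \sum_(j < m) par j)).
  rewrite qX ler_expR lerN2 ler_wpM2l ?divr_ge0 ?sqr_ge0//.
  by rewrite natr_sum mulr_sumr; apply: ler_sum => j _.
have q0 k : 0 <= q ^+ k by rewrite exprn_ge0// expR_ge0.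
have q1 : q <= 1 by rewrite -expR0 ler_expR oppr_le0 mulr_ge0 ?divr_ge0 ?sqr_ge0.
have := parity_sum_ge am bm cm em; rewrite -/(par _) !geq_min.
have qle k l : (k <= l)%N -> q ^+ l <= q ^+ k.
  by move=> kl; rewrite ler_wiXn2l// expR_ge0.
rewrite /pairings => /orP[/orP[]|] /qle /le_trans; apply.
- by rewrite -addrA lerDl addr_ge0.
- by rewrite addrAC lerDr addr_ge0.
- by rewrite lerDr addr_ge0.
Qed.

Definition walk_sum (x : T) : R := \sum_(a < m) cos (W a x).
Local Notation C := walk_sum.

Let bcos a : bounded_measurable (fun x => cos (W a x)).
Proof. by have := bcosW a 0; under eq_fun do rewrite add0r. Qed.

Lemma bounded_measurable_walk_sum : bounded_measurable C.
Proof. exact: bounded_measurable_sum. Qed.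

Lemma Rintegral_walk_sum_sqr_ge :
  2^-1 * (\sum_(a < m) \sum_(b < m) q ^+ natdist a b) <= \int[P]_x C x ^+ 2.
Proof.
have bcc a b : bounded_measurable (fun x => cos (W a x) * cos (W b x)).
  exact: bounded_measurableM.
under eq_Rintegral => x _.
  by rewrite expr2 /walk_sum big_distrlr/=; over.
rewrite bRintegral_sum; last by move=> a; exact: bounded_measurable_sum.
rewrite mulr_sumr; apply: ler_sum => a _.
rewrite bRintegral_sum// mulr_sumr; apply: ler_sum => b _.
have mW := measurable_tail_walk.
under eq_Rintegral => x _.
  rewrite (_ : _ * _ = 2^-1 * (cos (W a x - W b x) + cos (W a x + W b x))); last first.
    by rewrite cosB cosD; field.
  over.
have b1 : bounded_measurable (fun x => cos (W a x - W b x)).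
  by apply: bounded_measurable_cos; exact: measurable_funB.
have b2 : bounded_measurable (fun x => cos (W a x + W b x)).
  by apply: bounded_measurable_cos; exact: measurable_funD.
rewrite bRintegralZ; last exact: bounded_measurableD.
rewrite bRintegralD// Rintegral_cos_walkB; [|exact: ltnW..].
by rewrite ler_wpM2l ?invr_ge0// lerDl.
Qed.

Let Rintegral_prod4_le a b c e :
  (a <= m)%N -> (b <= m)%N -> (c <= m)%N -> (e <= m)%N ->
  \int[P]_x ((cos (W a x) * cos (W b x)) * (cos (W c x) * cos (W e x)))
  <= pairings a b c e.
Proof.
move=> am bm cm em.
pose u (e1 e2 e3 : bool) x := cos (W a x + (- 1) ^+ e1 * W b x
  + (- 1) ^+ e2 * W c x + (- 1) ^+ e3 * W e x).
have bu e1 e2 e3 : bounded_measurable (u e1 e2 e3).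
  have mW := measurable_tail_walk.
  apply: bounded_measurable_cos.
  by do 3 (apply: measurable_funD; last exact: measurable_funM).
under eq_Rintegral => x _.
  (* A product of four cosines is the average of the cosines of the eight signed sums of their
     angles, the first sign being fixed. *)
  rewrite (_ : _ * _ = 8^-1 * \sum_(i : bool) \sum_(j : bool) \sum_(k : bool) u i j k x);
    last first.
    rewrite !big_bool/= /u !expr0 !expr1 !mul1r !mulN1r.
    by rewrite !(cosD, sinD, cosN, sinN); field.
  over.
rewrite bRintegralZ; last by do 3 (apply: bounded_measurable_sum => ?).
rewrite ler_pdivrMl// bRintegral_sum; last by move=> i; do 2 (apply: bounded_measurable_sum => ?).
apply: (@le_trans _ _ (\sum_(i : bool) \sum_(j : bool) \sum_(k : bool) pairings a b c e)).
  apply: ler_sum => i _; rewrite bRintegral_sum; last by move=> j; exact: bounded_measurable_sum.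
  apply: ler_sum => j _; rewrite bRintegral_sum//.
  by apply: ler_sum => k _; exact: Rintegral_cos_walk4_le.
by rewrite !big_bool/=; lra.
Qed.

(** After renaming the indices, each of the three pairings contributes the square of the double
    sum. *)
Lemma Rintegral_walk_sum_pow4_le :
  \int[P]_x C x ^+ 4 <=
  3 * (\sum_(a < m) \sum_(b < m) q ^+ natdist a b) ^+ 2.
Proof.
pose v (p : 'I_m * 'I_m) x := cos (W p.1 x) * cos (W p.2 x).
have bv p : bounded_measurable (v p) by exact: bounded_measurableM.
under eq_Rintegral => x _.
  rewrite (_ : _ ^+ 4 = \sum_(p : 'I_m * 'I_m) \sum_(r : 'I_m * 'I_m) v p x * v r x); last first.
    rewrite -big_distrlr/= -expr2 /v.
    rewrite -(pair_big xpredT xpredT (fun i j : 'I_m => cos (W i x) * cos (W j x)))/=.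
    by rewrite -big_distrlr/= -/(C x); ring.
  over.
have bvv p r : bounded_measurable (fun x => v p x * v r x) by exact: bounded_measurableM.
rewrite bRintegral_sum; last by move=> p; exact: bounded_measurable_sum.
under eq_bigr do rewrite bRintegral_sum//.
apply: (@le_trans _ _ (\sum_(p : 'I_m * 'I_m) \sum_(r : 'I_m * 'I_m)
    pairings p.1 p.2 r.1 r.2)).
  apply: ler_sum => p _; apply: ler_sum => r _.
  by apply: Rintegral_prod4_le; exact: ltnW.
set S := \sum_(a < m) _.
have SE : S = \sum_(p : 'I_m * 'I_m) q ^+ natdist p.1 p.2.
  exact: (pair_big xpredT xpredT (fun i j : 'I_m => q ^+ natdist i j)).
under eq_bigr do rewrite !big_split/=.
rewrite !big_split/= (_ : 3 * S ^+ 2 = S ^+ 2 + S ^+ 2 + S ^+ 2); last by ring.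
have unpair (F : nat -> nat -> nat -> nat -> R) :
    \sum_(p : 'I_m * 'I_m) \sum_(r : 'I_m * 'I_m) F p.1 p.2 r.1 r.2 =
    \sum_(a < m) \sum_(b < m) \sum_(c < m) \sum_(e < m) F a b c e.
  rewrite -(pair_big xpredT xpredT (fun i j : 'I_m =>
    \sum_(r : 'I_m * 'I_m) F i j r.1 r.2))/=.
  apply: eq_bigr => a _; apply: eq_bigr => b _.
  by rewrite -(pair_big xpredT xpredT (fun i j : 'I_m => F a b i j)).
have S4 : S ^+ 2 = \sum_(a < m) \sum_(b < m) \sum_(c < m) \sum_(e < m)
    q ^+ (natdist a b + natdist c e).
  rewrite -(unpair (fun a b c e => q ^+ (natdist a b + natdist c e))).
  rewrite expr2 SE big_distrlr/=.
  by apply: eq_bigr => p _; apply: eq_bigr => r _; rewrite exprD.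
rewrite (unpair (fun a b c e => q ^+ (natdist a b + natdist c e))).
rewrite (unpair (fun a b c e => q ^+ (natdist a c + natdist b e))).
rewrite (unpair (fun a b c e => q ^+ (natdist a e + natdist b c))).
rewrite -S4 [X in _ + X + _ <= _](_ : _ = S ^+ 2); last first.
  by rewrite S4; apply: eq_bigr => a _; rewrite exchange_big.
rewrite [X in _ + X <= _](_ : _ = S ^+ 2)// S4; apply: eq_bigr => a _.
under eq_bigr do rewrite exchange_big/=.
by rewrite exchange_big.
Qed.

End walk_moments.

(* With [y = |x| / rho] this is [y^2 - y^4 <= y]. *)
Lemma fourth_moment_ineq (R : realType) (rho x : R) : 0 < rho ->
  x ^+ 2 / rho - x ^+ 4 / rho ^+ 3 <= `|x|.
Proof.
move=> r0; pose y := `|x| / rho.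
have y0 : 0 <= y by rewrite divr_ge0// ltW.
have -> : x ^+ 2 / rho - x ^+ 4 / rho ^+ 3 = rho * (y ^+ 2 - y ^+ 4).
  rewrite /y !expr_div_n -[`|x| ^+ 4]/(`|x| ^+ (2 * 2)) exprM real_normK ?num_real//.
  by rewrite -exprM; field; rewrite gt_eqF.
have -> : `|x| = rho * y by rewrite /y mulrC divfK// gt_eqF.
rewrite ler_pM2l//; have [y1|y1] := leP y 1.
  have : 0 <= y ^+ 4 by rewrite exprn_ge0.
  have : y ^+ 2 <= y by rewrite expr2 ler_piMr.
  lra.
have : 0 <= y ^+ 2 * (y ^+ 2 - 1).
  by rewrite mulr_ge0 ?sqr_ge0// subr_ge0 expr2 mulr_ege1// ltW.
by rewrite (_ : y ^+ 4 = y ^+ 2 * y ^+ 2); [nra|rewrite -exprD].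
Qed.

(** Both bounds come from [1 + y <= exp y]: the upper one at [y = - x]; the lower one at [y = x],
    where it gives [1 - exp(- x) >= x / (1 + x)]. *)
Lemma onem_expRN_bounds (R : realType) (x : R) : 0 <= x <= 1 ->
  x / 2 <= 1 - expR (- x) <= x.
Proof.
move=> /andP[x0 x1]; have := expR_ge1Dx (- x) => h1.
apply/andP; split; last by lra.
have h2 := expR_ge1Dx x; have e0 := expR_gt0 (- x).
have e1 : expR x * expR (- x) = 1 by rewrite -expRD subrr expR0.
have : (1 + x) * expR (- x) <= 1 by rewrite -[leRHS]e1 ler_wpM2r ?(ltW e0).
nra.
Qed.

Section walk_lower_bound.
Context d (T : measurableType d) (R : realType) (P : probability T R).
Variables (n : nat) (t kap lam : R) (xi : nat -> T -> R).
Local Notation m := n.*2.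
Local Notation dt := (t / m%:R).
Hypotheses (lamE : kap ^+ 2 / 2 = lam) (n0 : (0 < n)%N) (t0 : 0 < t) (lt2 : 2 <= lam * t)
  (ldt1 : lam * dt <= 1).
Hypothesis iid : iid_gaussian P m (Num.sqrt dt) xi.

(** Since [1 - q] is comparable to [lam dt], the double sum [S] is, up to constants, [t / dt] points
    times a correlation length of [1 / (lam dt)] steps. The mesh then cancels from both moments,
    which [fourth_moment_ineq] combines. *)
Lemma walk_sum_lower_bound :
  Num.sqrt (t / lam) / 512 <= \int[P]_x `|dt * walk_sum m kap xi x|.
Proof.
set C := walk_sum m kap xi.
have m0 : 0 < m%:R :> R by rewrite ltr0n double_gt0.
have nR0 : 0 < n%:R :> R by rewrite ltr0n.
have mE : m%:R = 2 * n%:R :> R by rewrite -mul2n natrM.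
have dt0 : 0 < dt by rewrite divr_gt0.
have lam0 : 0 < lam by rewrite -(pmulr_lgt0 _ t0) (lt_le_trans _ lt2).
have s0 : 0 < Num.sqrt dt by rewrite sqrtr_gt0.
have bC : bounded_measurable C by exact: (bounded_measurable_walk_sum kap iid).
have M2 := Rintegral_walk_sum_sqr_ge kap s0 iid.
have M4 := Rintegral_walk_sum_pow4_le kap s0 iid.
rewrite sqr_sqrtr ?(ltW dt0)// -/C in M2 M4.
have qE : expR (- (dt / 2 * kap ^+ 2)) = expR (- (lam * dt)).
  by congr (expR (- _)); rewrite -lamE; field; rewrite gt_eqF.
rewrite qE in M2 M4; set q := expR (- (lam * dt)) in M2 M4.
have ldt0 : 0 < lam * dt by rewrite mulr_gt0.
have /andP[r1 r2] : lam * dt / 2 <= 1 - q <= lam * dt.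
  by apply: onem_expRN_bounds; rewrite (ltW ldt0).
have r0 : 0 < 1 - q by rewrite (lt_le_trans _ r1)// divr_gt0.
have q01 : 0 <= q < 1 by rewrite expR_ge0/= -subr_gt0.
have := sum_natdist_le q01 m; have := sum_natdist_ge q01 n.
set S := \sum_(a < m) _ in M2 M4 * => S1 S2.
(* [q^n = exp(- lam t / 2)], and [lam t >= 2] gives [exp(lam t / 2) >= 1 + lam t / 2 >= 2]. *)
have qn : q ^+ n <= 2^-1.
  rewrite -expRM_natl (_ : _ * _ = - (lam * t / 2)); last first.
    by rewrite mE; field; rewrite gt_eqF.
  have h1 := expR_ge1Dx (lam * t / 2); have e0 := expR_gt0 (- (lam * t / 2)).
  have e1 : expR (lam * t / 2) * expR (- (lam * t / 2)) = 1.
    by rewrite -expRD subrr expR0.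
  have : 2 * expR (- (lam * t / 2)) <= expR (lam * t / 2) * expR (- (lam * t / 2)).
    rewrite ler_wpM2r ?(ltW e0)// (le_trans _ h1)//.
    by rewrite -[leLHS]/(1 + 1) lerD2l ler_pdivlMr// mul1r.
  lra.
have {}S1 : t / (4 * lam * dt ^+ 2) <= S.
  apply: le_trans S1.
  have -> : t / (4 * lam * dt ^+ 2) = n%:R * (2^-1 / (lam * dt)).
    by rewrite mE; field; rewrite !gt_eqF.
  rewrite ler_pM2l//; apply: ler_pM; rewrite ?invr_ge0 ?(ltW ldt0)//; first lra.
  by rewrite lef_pV2.
have {}S2 : S <= 4 * t / (lam * dt ^+ 2).
  apply: (le_trans S2).
  have -> : 4 * t / (lam * dt ^+ 2) = m%:R * (2 / (lam * dt / 2)).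
    by rewrite mE; field; rewrite !gt_eqF.
  rewrite ler_pM2l// ler_pM2l// lef_pV2// posrE; lra.
have S0 : 0 <= S.
  by do 2 (apply: sumr_ge0 => ? _); rewrite exprn_ge0//; case/andP: q01.
pose w := Num.sqrt (t / lam).
have tl0 : 0 < t / lam by rewrite divr_gt0.
have w0 : 0 < w by rewrite sqrtr_gt0.
have w2 : w ^+ 2 = t / lam by rewrite sqr_sqrtr ?(ltW tl0).
(* At this level the loss [48 w^4 / rho^3] is [(3/64) w^2 / rho], less than half of the gain
   [w^2 / (8 rho)]. The half that is kept is [w^2 / (16 rho) = w / 512]. *)
pose rho := 32 * w.
have rho0 : 0 < rho by rewrite mulr_gt0.
have bX k : bounded_measurable (fun x => C x ^+ k).
  elim: k => [|k IH]; first exact: bounded_measurable_cst.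
  by under eq_fun do rewrite exprS; exact: bounded_measurableM.
have E2 : w ^+ 2 / 8 <= dt ^+ 2 * \int[P]_x C x ^+ 2.
  rewrite w2; apply: (@le_trans _ _ (dt ^+ 2 * (2^-1 * (t / (4 * lam * dt ^+ 2))))).
    by rewrite le_eqVlt; apply/orP; left; apply/eqP; field; rewrite !gt_eqF.
  by rewrite ler_wpM2l ?sqr_ge0// (le_trans _ M2)// ler_wpM2l// invr_ge0.
have E4 : dt ^+ 4 * \int[P]_x C x ^+ 4 <= 48 * w ^+ 4.
  rewrite (_ : w ^+ 4 = (t / lam) ^+ 2); last by rewrite -w2 -exprM.
  apply: (@le_trans _ _ (dt ^+ 4 * (3 * (4 * t / (lam * dt ^+ 2)) ^+ 2))).
    rewrite ler_wpM2l ?exprn_ge0 ?(ltW dt0)// (le_trans M4)// ler_wpM2l//.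
    by rewrite ler_pXn2r// ?nnegrE ?(le_trans S0).
  by rewrite le_eqVlt; apply/orP; left; apply/eqP; field; rewrite !gt_eqF.
have bA : bounded_measurable (fun x => `|dt * C x|).
  have [mX [M XM]] := bounded_measurableM (@bounded_measurable_cst _ T _ dt) bC.
  split; last by exists M => x; rewrite normr_id.
  exact: (measurableT_comp (@normr_measurable _ _)).
have bP : bounded_measurable (fun x => dt ^+ 2 / rho * C x ^+ 2
    + (- (dt ^+ 4 / rho ^+ 3)) * C x ^+ 4).
  by apply: bounded_measurableD; apply: bounded_measurableM => //;
    exact: bounded_measurable_cst.
apply: (@le_trans _ _ (\int[P]_x (dt ^+ 2 / rho * C x ^+ 2
    + (- (dt ^+ 4 / rho ^+ 3)) * C x ^+ 4))); last first.
  apply: le_Rintegral => //; try exact: bounded_measurable_integrable.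
  move=> x _; apply: le_trans (fourth_moment_ineq (dt * C x) rho0).
  by rewrite le_eqVlt; apply/orP; left; apply/eqP; field; rewrite !gt_eqF.
rewrite bRintegralD; try by apply: bounded_measurableM => //; exact: bounded_measurable_cst.
rewrite !bRintegralZ// -/w.
have -> : w / 512 = (w ^+ 2 / 16) / rho by rewrite /rho; field; rewrite gt_eqF.
have F2 : (w ^+ 2 / 8) / rho <= dt ^+ 2 / rho * \int[P]_x C x ^+ 2.
  by rewrite [X in _ <= X]mulrAC ler_pM2r ?invr_gt0.
have F4 : dt ^+ 4 / rho ^+ 3 * \int[P]_x C x ^+ 4 <= (48 * w ^+ 4) / rho ^+ 3.
  by rewrite [X in X <= _]mulrAC ler_pM2r ?invr_gt0 ?exprn_gt0.
have F5 : (48 * w ^+ 4) / rho ^+ 3 = (48 / 1024) * w ^+ 2 / rho.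
  by rewrite /rho; field; rewrite gt_eqF.
have F6 : w ^+ 2 / 16 / rho + (48 / 1024) * w ^+ 2 / rho <= w ^+ 2 / 8 / rho.
  by rewrite -mulrDl ler_pM2r ?invr_gt0//; have := sqr_ge0 w; lra.
by lra.
Qed.

End walk_lower_bound.

(** * From Brownian motion to Riemann sums *)

Section brownian_increments.
Context d (T : measurableType d) (R : realType) (P : probability T R).
Variable W : R -> 'I_3 -> {RV P >-> R}.
Hypothesis BW : brownian_motion W.
Variables (dt : R) (i : 'I_3) (m : nat).
Hypothesis dt0 : 0 < dt.

Definition increments (k : nat) (om : T) : R :=
  W (dt * k.+1%:R) i om - W (dt * k%:R) i om.

(** The product rule for all three coordinates is used with the whole line as event for those other
    than [i]; their factors are 1. *)
Lemma iid_increments : iid_gaussian P m (Num.sqrt dt) increments.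
Proof.
have [_ _ lawW indepW] := BW.
have dtk k : dt * k.+1%:R - dt * k%:R = dt.
  by rewrite -mulrBr -natrB// subSnn mulr1.
split.
- by move=> k; apply: measurable_funB; exact: measurable_funP.
- move=> k B _ mB; rewrite -[X in Num.sqrt X](dtk k); apply: lawW => //.
    by rewrite mulr_ge0 ?(ltW dt0).
  by rewrite ltr_pM2l// ltr_nat.
move=> B mB.
have t0 : 0 <= dt * 0%:R by rewrite mulr0.
have tS k : dt * k%:R < dt * k.+1%:R by rewrite ltr_pM2l// ltr_nat.
have := indepW m (fun k => dt * k%:R) t0 tS
  (fun ik : 'I_3 * 'I_m => if ik.1 == i then B ik.2 else setT).
move=> /(_ _)/= H.
transitivity (P [set om | forall ik : 'I_3 * 'I_m,
    (if ik.1 == i then B ik.2 else setT)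
    (W (dt * ik.2.+1%:R) ik.1 om - W (dt * ik.2%:R) ik.1 om)]).
  congr (P _); apply/seteqP; split => om /= h.
    by move=> [j k]/=; case: eqP => // ->; exact: h.
  by move=> k km; have := h (i, Ordinal km); rewrite /= eqxx.
rewrite H; last by move=> ik; case: ifP.
rewrite -(pair_big xpredT xpredT (fun (j : 'I_3) (k : 'I_m) =>
  P ((fun om => W (dt * k.+1%:R) j om - W (dt * k%:R) j om) @^-1`
     (if j == i then B k else setT))))/=.
rewrite (bigD1 i)//= [X in (_ * X)%E]big1 ?mule1.
  by apply: eq_bigr => k _; rewrite eqxx.
move=> j ji; rewrite big1// => k _; rewrite (negbTE ji) preimage_setT.
exact: probability_setT.
Qed.

Lemma tail_walk_increments kap a om : (a <= m)%N ->
  tail_walk m kap increments a om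
  = kap * (W (dt * m%:R) i om - W (dt * a%:R) i om).
Proof.
rewrite /tail_walk /increments; elim: m => [|n IH].
  by rewrite leqn0 => /eqP ->; rewrite big_ord0 subrr mulr0.
rewrite leq_eqVlt => /predU1P[->|].
  rewrite subrr mulr0 big1// => -[k kn] _ /=.
  by rewrite leqNgt kn mulr0 mul0r.
by rewrite ltnS => an; rewrite big_ord_recr/= IH// an mulr1 -mulrDr addrC addrA subrK.
Qed.

End brownian_increments.

Section riemann_sums.
Context {R : realType}.
Local Notation mu := (@lebesgue_measure R).
Variables (t M : R) (h : R -> R).
Hypotheses (t0 : 0 < t) (hM : forall s, `|h s| <= M).
Hypothesis ch : {within `[0, t], continuous h}.

Let step m s : R :=
  \sum_(a < m) h (t / m%:R * a%:R) * \1_`[t / m%:R * a%:R, t / m%:R * a.+1%:R[ s.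

(** [r] is the left end of the grid cell of [s], whose index is the integer part of [s / dt]. The
    cells are half-open, so just one term of the sum survives. *)
Let stepE m s : (0 < m)%N -> 0 <= s < t -> exists r,
  [/\ step m s = h r, 0 <= r <= t & `|s - r| <= t / m%:R].
Proof.
move=> m0 /andP[s0 st]; set dt := t / m%:R.
have mR0 : 0 < m%:R :> R by rewrite ltr0n.
have dt0 : 0 < dt by rewrite divr_gt0.
pose k := Num.truncn (s / dt).
have sdt0 : 0 <= s / dt by rewrite divr_ge0// ltW.
have /andP[k1 k2] : k%:R <= s / dt < k.+1%:R by exact: truncn_itv.
have {}k1 : dt * k%:R <= s by rewrite mulrC -ler_pdivlMr.
have {}k2 : s < dt * k.+1%:R by rewrite mulrC -ltr_pdivrMr.
have km : (k < m)%N.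
  rewrite -(ltr_nat R) -(ltr_pM2l dt0) (le_lt_trans k1)//.
  by rewrite /dt divfK// gt_eqF.
have dkS : dt * k.+1%:R = dt * k%:R + dt by rewrite -natr1 mulrDr mulr1.
exists (dt * k%:R); split.
- rewrite /step (bigD1 (Ordinal km))//= indicE mem_set ?mulr1; last first.
    by rewrite /= in_itv/= k1.
  rewrite big1 ?addr0// => -[j jm] /= jk; rewrite indicE memNset ?mulr0//=.
  rewrite in_itv/= => /andP[j1 j2]; move: jk; apply/negP; rewrite negbK.
  rewrite -val_eqE/= eqn_leq; apply/andP; split.
    by rewrite -ltnS -(ltr_nat R) -(ltr_pM2l dt0) (le_lt_trans j1).
  by rewrite -ltnS -(ltr_nat R) -(ltr_pM2l dt0) (le_lt_trans k1).
- by rewrite mulr_ge0 ?(ltW dt0)//= (le_trans k1)// ltW.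
- by rewrite ger0_norm ?subr_ge0// lerBlDl -dkS ltW.
Qed.

Let integral_step m : (0 < m)%N ->
  (\int[mu]_(s in `[0%R, t[) (step m s)%:E =
   (t / m%:R * \sum_(a < m) h (t / m%:R * a%:R))%:E)%E.
Proof.
move=> m0; set dt := t / m%:R.
have mR0 : 0 < m%:R :> R by rewrite ltr0n.
have dt0 : 0 < dt by rewrite divr_gt0.
have int1 (a b : R) : mu.-integrable `[0%R, t[ (EFin \o \1_`[a, b[).
  apply: measurable_bounded_integrable => //.
  - by rewrite /= lebesgue_measure_itv/= lte_fin t0 -EFinB ltry.
  - exists 1; split=> // y y1 x _ /=; rewrite (le_trans _ (ltW y1))//.
    by rewrite ger0_norm// indicE; case: (_ \in _).
have int2 (c a b : R) : mu.-integrable `[0%R, t[ (fun s => (c * \1_`[a, b[ s)%:E).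
  have := @integrableZl _ _ _ mu _ (measurable_itv _) c _ (int1 a b).
  by apply: eq_integrable => // s _; rewrite EFinM.
under eq_integral do rewrite /step -sumEFin.
rewrite integral_sum//.
rewrite mulr_sumr -sumEFin; apply: eq_bigr => a _.
under eq_integral do rewrite EFinM.
rewrite integralZl//; last exact: int1.
rewrite integral_indic// setIidl.
  rewrite /= lebesgue_measure_itv/= lte_fin ltr_pM2l// ltr_nat ltnSn -EFinB -EFinM.
  by rewrite -mulrBr -natrB// subSnn mulr1 mulrC.
move=> s /=; rewrite !in_itv/= => /andP[s1 s2]; apply/andP; split.
  by rewrite (le_trans _ s1)// mulr_ge0 ?(ltW dt0).
rewrite (lt_le_trans s2)// -[leRHS](divfK (lt0r_neq0 mR0)) -/dt.
by rewrite ler_pM2l// ler_nat.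
Qed.

Let cvg_mesh : t / k.+1.*2%:R @[k --> \oo] --> 0.
Proof.
apply: (@squeeze_cvgr _ _ _ _ (cst 0) (fun k => t * harmonic k)).
- near=> k; rewrite divr_ge0 ?(ltW t0)//= ler_pM2l// lef_pV2 ?posrE ?ltr0n//.
  by rewrite ler_nat -addnn leq_addr.
- exact: cvg_cst.
- by rewrite -[X in _ --> X](mulr0 t); apply: cvgM; [exact: cvg_cst|exact: cvg_harmonic].
Unshelve. all: by end_near. Qed.

Let cvg_step s : 0 <= s < t -> step k.+1.*2 s @[k --> \oo] --> h s.
Proof.
move=> st; have /andP[s0 st'] := st.
have hs : h x @[x --> within `[0, t] (nbhs s)] --> h s.
  by move/subspace_continuousP : ch; apply; rewrite /= in_itv/= s0 ltW.
apply/cvgrPdist_lt => e e0.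
move/cvgrPdist_lt : hs => /(_ _ e0).
rewrite near_withinE => -[r /= r0 hr].
move/cvgrPdist_lt : cvg_mesh => /(_ _ r0) mesh.
near=> k.
have [//|u [-> u0t su]] := @stepE k.+1.*2 s _ st.
apply: hr; last by rewrite /= in_itv/=.
rewrite /= (le_lt_trans su)// (le_lt_trans (ler_norm _))// -normrN -sub0r.
by near: k.
Unshelve. all: by end_near. Qed.

(** The Riemann sum is the integral of [step], which tends to [h] pointwise by continuity and is
    bounded by [M]; dominated convergence concludes. The grid sizes are even for the sake of
    [sum_natdist_ge]. *)
Lemma cvg_riemann_sum :
  t / k.+1.*2%:R * \sum_(a < k.+1.*2) h (t / k.+1.*2%:R * a%:R) @[k --> \oo]
  --> \int[mu]_(s in `[0, t]) h s.
Proof.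
have mh : measurable_fun `[0, t] h.
  exact: subspace_continuous_measurable_fun.
have mh' : measurable_fun `[0, t[ h.
  apply: measurable_funS mh => //.
  exact: subset_itv_co_cc.
have mstep m : measurable_fun `[0, t[ (step m).
  apply: measurable_sum => a; apply: measurable_funM => //.
have inth : mu.-integrable `[0%R, t[ (EFin \o h).
  apply: measurable_bounded_integrable => //.
    by rewrite /= lebesgue_measure_itv/= lte_fin t0 -EFinB ltry.
  by exists M; split=> [|y y1 x _ /=]; rewrite ?num_real// (le_trans (hM x))// ltW.
(* The step functions vanish at [t]. *)
rewrite -Rintegral_itv_bndo_bndc//.
have cI : (\int[mu]_(s in `[0%R, t[) (step k.+1.*2 s)%:E @[k --> \oo]
    --> \int[mu]_(s in `[0%R, t[) (h s)%:E)%E.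
  have M0 : 0 <= M by exact: le_trans (hM 0).
  apply: (@dominated_cvg _ _ _ mu _ (measurable_itv _)
    (fun k s => (step k.+1.*2 s)%:E) (EFin \o h) (cst M%:E)) => //.
  - by move=> k; apply/measurable_EFinP; exact: mstep.
  - move=> s /=; rewrite in_itv/= => st; apply: cvg_EFin; first exact: nearW.
    exact: cvg_step.
  - apply: measurable_bounded_integrable => //.
      by rewrite /= lebesgue_measure_itv/= lte_fin t0 -EFinB ltry.
    exact: bounded_cst.
  - move=> k s /=; rewrite in_itv/= => st; rewrite lee_fin.
    by have [//|u [-> _ _]] := @stepE k.+1.*2 s _ st.
have Ifin : (\int[mu]_(s in `[0%R, t[) (h s)%:E)%E \is a fin_num.
  by apply: integrable_fin_num inth.
move: cI; rewrite -(fineK Ifin).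
under eq_fun do rewrite integral_step//.
by move=> /fine_cvg.
Qed.

End riemann_sums.

(** * Integrals of functions not known to be measurable *)

Section nonmeasurable_integrands.
Local Open Scope ereal_scope.
Context d (T : measurableType d) (R : realType) (mu : {measure set T -> \bar R}).

Import HBNNSimple.

(* Neither function is assumed measurable, which [ge0_le_integral] requires. *)
Lemma ge0_ae_le_integral (f g : T -> \bar R) :
  (forall x, 0 <= f x) -> (forall x, 0 <= g x) ->
  {ae mu, forall x, f x <= g x} -> \int[mu]_x f x <= \int[mu]_x g x.
Proof.
move=> f0 g0 [N [mN N0 fgN]].
rewrite [leLHS]ge0_integralTE//; apply: ge_ereal_sup => _ [h /= hf <-].
have mCN : measurable (~` N) by exact: measurableC.
(* A simple function below [f] may exceed [g] on the null set [N]; it is set to 0 there, which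
   leaves its integral unchanged. *)
pose h' := proj_nnsfun h mCN.
have h'E x : h' x = (h \_ (~` N)) x by rewrite (mrestrict h mCN).
have -> : sintegral mu h = sintegral mu h'.
  rewrite -!integralT_nnsfun; apply: ge0_ae_eq_integral => //.
  - by apply/measurable_EFinP.
  - by apply/measurable_EFinP.
  - by move=> x _; rewrite lee_fin.
  - by move=> x _; rewrite lee_fin.
  - exists N; split => // x /= hx; apply: contrapT => Nx; apply: hx => _.
    by have := h'E x; rewrite patchE mem_set//= => ->.
rewrite ge0_integralTE//; apply: ereal_sup_ubound; exists h' => //= x.
have := h'E x; rewrite patchE /= => ->; case: ifPn => [|_]; last exact: g0.
rewrite inE => Nx; rewrite (le_trans (hf x))//.
by apply: contrapT => fg; apply: Nx; exact: fgN.
Qed.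

Lemma ae_eq_integralT (f g : T -> \bar R) :
  {ae mu, forall x, f x = g x} -> \int[mu]_x f x = \int[mu]_x g x.
Proof.
move=> fg; rewrite integralE [RHS]integralE; congr (_ - _).
- by apply/eqP; rewrite eq_le; apply/andP; split; apply: ge0_ae_le_integral => //;
    apply: filterS fg => x fgx; rewrite !funeposE fgx.
- by apply/eqP; rewrite eq_le; apply/andP; split; apply: ge0_ae_le_integral => //;
    apply: filterS fg => x fgx; rewrite !funenegE fgx.
Qed.

End nonmeasurable_integrands.

(** [G] may fail to be measurable, so [F k] and [G] are first set to 0 on a measurable null set
    containing the exceptional points. The new [G'] is an everywhere limit of measurable functions,
    and [ae_eq_integralT] carries its mean over to [G]. *)
Lemma expectation_ae_cvg d (T : measurableType d) (R : realType)
    (P : probability T R) (F : nat -> T -> R) (G : T -> R) (M : R) :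
  (forall k, measurable_fun [set: T] (F k)) -> (forall k x, `|F k x| <= M) ->
  {ae P, forall x, F k x @[k --> \oo] --> G x} ->
  ('E_P[G])%E \is a fin_num /\
  \int[P]_x F k x @[k --> \oo] --> fine ('E_P[G])%E.
Proof.
move=> mF FM [N [mN N0 FGN]].
have mCN : measurable (~` N) by exact: measurableC.
pose G' := G \_ (~` N); pose F' k := F k \_ (~` N).
have FG' x : F' k x @[k --> \oo] --> G' x.
  rewrite /F' /G'; under eq_fun do rewrite patchE; rewrite patchE.
  case: ifPn => [|_]; last exact: cvg_cst.
  by rewrite inE => Nx; apply: contrapT => h; apply: Nx; exact: FGN.
have bF k : bounded_measurable (F k) by split=> //; exists M.
have mF' k : measurable_fun [set: T] (F' k).
  by have [] := bounded_measurable_patch mCN (bF k).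
have F'M k x : `|F' k x| <= M.
  rewrite /F' patchE; case: ifP => // _; rewrite -[point]/(0 : R) normr0.
  exact: le_trans (FM k x).
have intM : P.-integrable setT (cst M%:E).
  exact: bounded_measurable_integrable (@bounded_measurable_cst _ T _ M).
have cI : (\int[P]_x (F' k x)%:E @[k --> \oo] --> \int[P]_x (G' x)%:E)%E.
  apply: (@dominated_cvg _ _ _ P _ measurableT (fun k x => (F' k x)%:E)
    (EFin \o G') (cst M%:E)) => //.
  - by move=> k; exact/measurable_EFinP.
  - by move=> x _; apply: cvg_EFin; [exact: nearW|exact: FG'].
  - by move=> k x _; rewrite /= lee_fin.
have bG' : bounded_measurable G'.
  split; first by apply: (measurable_fun_cvg (h := F')) => // x _.
  exists M => x; rewrite -(cvg_lim _ (cvg_norm (FG' x)))//.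
  apply: limr_le; last exact: nearW.
  by apply: is_cvg_norm; apply/cvg_ex; exists (G' x).
have EG : ('E_P[G] = \int[P]_x (G' x)%:E)%E.
  rewrite unlock; apply: ae_eq_integralT; exists N; split => // x /= h.
  apply: contrapT => Nx; apply: h; congr (_%:E).
  by rewrite /G' patchE mem_set.
have intG' := bounded_measurable_integrable P measurableT bG'.
have finG : (\int[P]_x (G' x)%:E)%E \is a fin_num by exact: integrable_fin_num.
rewrite EG; split=> //.
move: cI; rewrite -(fineK finG) => /fine_cvg.
apply: cvg_trans; apply: near_eq_cvg; apply: nearW => k /=.
congr fine; apply: ae_eq_integralT; exists N; split => // x /= h.
apply: contrapT => Nx; apply: h; congr (_%:E).
by rewrite /F' patchE mem_set.
Qed.

(** * The shear field and its inverse flow *)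

Section coordinate_derivatives.
Context {R : realType}.
Implicit Types (x v : 'cV[R]_3).

Lemma is_derive_line (f : 'cV[R]_3 -> R) x v (df : R) :
  is_derive (0 : R) 1 (fun h : R => f (h *: v + x)) df -> is_derive x v f df.
Proof.
move=> [D E]; have e : (fun h : R => h^-1 *: ((f \o shift x) (h *: v) - f x)) =
   (fun h : R => h^-1 *: (((fun h : R => f (h *: v + x)) \o shift 0) (h *: 1)
      - f (0 *: v + x))).
  by apply/funext => h /=; rewrite addr0 scale0r add0r /GRing.scale/= mulr1.
split; first by rewrite /derivable e; exact: D.
by rewrite /derive e; exact: E.
Qed.

Lemma is_derive_coord (g : R -> R) (dg : R) x (i j : 'I_3) :
  is_derive (x i 0) 1 g dg ->
  is_derive x (delta_mx j 0) (fun y : 'cV[R]_3 => g (y i 0)) ((i == j)%:R * dg).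
Proof.
move=> Dg; apply: is_derive_line.
under eq_fun do rewrite !mxE eqxx andbT.
have [ij|ij] := eqVneq i j; rewrite /= ?mul1r ?mul0r.
  under eq_fun do rewrite mulr1.
  have d1 : is_derive (0 : R) 1 (fun h : R => h + x i 0) 1.
    by apply: is_derive_eq; rewrite addr0.
  have Dg' : is_derive (0 + x i 0) 1 g dg by rewrite add0r.
  have := @is_derive1_comp R g (fun h : R => h + x i 0) 0 dg 1 Dg' d1.
  by rewrite mulr1.
under eq_fun do rewrite mulr0 add0r.
exact: is_derive_cst.
Qed.

Lemma partial_d_coord (g : R -> R) (dg : R) x (i j : 'I_3) :
  is_derive (x i 0) 1 g dg ->
  partial_d j (fun y : 'cV[R]_3 => g (y i 0)) x = (i == j)%:R * dg.
Proof. by move=> Dg; have D := is_derive_coord j Dg; apply: derive_val. Qed.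

End coordinate_derivatives.

Section shear_field.
Context {R : realType} (nu al : R).

(** The phase [+ 0] gives the field the shape [c sin(K y + p)], which all partial derivatives
    preserve: they multiply [c] by a constant and shift [p] by [pi / 2]. *)
Lemma component_shear K i : component (shear nu al K) i =
  (fun x => (i == 0)%:R * amplitude nu al K * sin (K * x 1 0 + 0)).
Proof.
apply/funext => x; rewrite /component /shear !mxE eqxx andbT addr0.
by rewrite mulrC mulrA.
Qed.

Lemma partial_d_sin (K c p : R) j :
  partial_d j (fun x : 'cV[R]_3 => c * sin (K * x 1 0 + p)) =
  (fun x => (1 == j)%:R * c * K * sin (K * x 1 0 + (p + pi / 2))).
Proof.
apply/funext => x.
have D : is_derive (x 1 0) 1 (fun y => c * sin (K * y + p))
    (c * (K * cos (K * x 1 0 + p))).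
  have D := is_derive_sin_affine p K (x 1 0).
  by apply: is_derive_eq; rewrite /GRing.scale/=; ring.
rewrite (partial_d_coord j D).
have -> : cos (K * x 1 0 + p) = sin (K * x 1 0 + (p + pi / 2)).
  by rewrite addrA sinD cos_pihalf sin_pihalf mulr0 add0r mulr1.
ring.
Qed.

Lemma smooth3_shear K i : smooth3 (component (shear nu al K) i).
Proof.
move=> s; rewrite component_shear.
have [c [p ->]] : exists c p, foldr partial_d (fun x : 'cV[R]_3 =>
    (i == 0)%:R * amplitude nu al K * sin (K * x 1 0 + 0)) s =
    (fun x => c * sin (K * x 1 0 + p)).
  elim: s => [|j s [c [p IH]]].
    by exists ((i == 0)%:R * amplitude nu al K), 0.
  by rewrite /= IH partial_d_sin; eexists; eexists.
have D (y : R) : is_derive y 1 (fun y => c * sin (K * y + p)) (c * (K * cos (K * y + p))).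
  have D := is_derive_sin_affine p K y.
  by apply: is_derive_eq; rewrite /GRing.scale/=; ring.
split; last first.
  by move=> j x; have Dj := is_derive_coord j (D (x 1 0)); exact: ex_derive.
move=> x; apply: (@continuous_comp _ _ _ (fun y : 'cV[R]_3 => y 1 0)
  (fun y => c * sin (K * y + p))); first exact: coord_continuous.
exact: is_derive_continuous D _.
Qed.

Lemma divergence_shear K x : divergence (shear nu al K) x = 0.
Proof.
rewrite /divergence big1// => i _; rewrite component_shear partial_d_sin.
by have [->|i0] := eqVneq i 0; rewrite ?mul0r ?mulr0 ?mul0r.
Qed.

Lemma sin_freq (n : nat) (u p : R) (k : int) :
  sin (freq n * (u + k%:~R) + p) = sin (freq n * u + p).
Proof.
have sinn m (v : R) : sin (v + (2 * pi) *+ m) = sin v.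
  by rewrite mulr_natl; exact: (periodicn (@sinD2pi R)).
rewrite /freq mulrDr; case: k => m.
  rewrite -[RHS](sinn (n * m)%N); congr sin.
  by rewrite -[(2 * pi) *+ _]mulr_natr natrM -pmulrn; ring.
rewrite -[LHS](sinn (n * m.+1)%N); congr sin.
by rewrite NegzE -[(2 * pi) *+ _]mulr_natr natrM mulrNz -pmulrn; ring.
Qed.

Lemma cos_freq (n : nat) (u : R) (k : int) :
  cos (freq n * (u + k%:~R)) = cos (freq n * u).
Proof.
have cosE (v : R) : cos v = sin (v + pi / 2).
  by rewrite sinD cos_pihalf sin_pihalf mulr0 add0r mulr1.
by rewrite !cosE sin_freq.
Qed.

Lemma z3_periodic_shear n : z3_periodic (shear nu al (freq n)).
Proof. by move=> x m; rewrite /shear !mxE -[freq n * (_ + _)]addr0 sin_freq addr0. Qed.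

End shear_field.

(** [C] and [S] will be the time integrals of the cosine and sine of [kap (w_t - w_s)]. They do not
    involve [y], so no derivative has to pass under the time integral. *)
Lemma grad_shear_inverse (R : realType) (c : 'I_3 -> R) (k K C S : R) x :
  grad (fun y : 'cV[R]_3 => \col_i (y i 0 - c i
    - (i == 0)%:R * (k * (sin (K * y 1 0) * C - cos (K * y 1 0) * S)))) x =
  1%:M - (k * K * (cos (K * x 1 0) * C + sin (K * x 1 0) * S)) *: delta_mx 0 1.
Proof.
apply/matrixP => i j; rewrite mxE /component.
have D1 := is_derive_coord j (is_derive_id (x i 0) (1 : R)).
pose g (y : R) := - ((i == 0)%:R * (k * (sin (K * y) * C - cos (K * y) * S))) - c i.
have Dg : is_derive (x 1 0) 1 g (- ((i == 0)%:R * (k * K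
    * (cos (K * x 1 0) * C + sin (K * x 1 0) * S)))).
  by apply: is_derive_eq; rewrite /GRing.scale/=; ring.
have D2 := is_derive_coord j Dg.
rewrite /partial_d.
have -> : (fun y : 'cV[R]_3 => (\col_i (y i 0 - c i
    - (i == 0)%:R * (k * (sin (K * y 1 0) * C - cos (K * y 1 0) * S)))) i 0) =
    (fun y : 'cV[R]_3 => y i 0 + g (y 1 0)).
  by apply/funext => y; rewrite mxE /g; ring.
rewrite (@derive_val _ _ _ _ _ _ _ (is_deriveD D1 D2)) !mxE.
rewrite (eq_sym 1 j); case: (i == 0); case: (j == 1); case: (i == j) => /=; ring.
Qed.

Section phase_integral.
Context {R : realType}.
Local Notation mu := (@lebesgue_measure R).
Variables (kap t : R) (w : R -> R).
Hypotheses (t0 : 0 < t) (cw : {within `[0, +oo[, continuous w}).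

Definition phase_integral (b : R) : R :=
  \int[mu]_(s in `[0, t]) cos (b + kap * (w t - w s)).

Lemma continuous_phase (b : R) :
  {within `[0, t], continuous (fun s => cos (b + kap * (w t - w s)))}.
Proof.
have cw' : {within `[0, t], continuous w}.
  apply: continuous_subspaceW cw => s /=; rewrite !in_itv/= => /andP[->].
  by [].
have cg : continuous (fun y => cos (b + kap * (w t - y))).
  have D (y : R) : is_derive y 1 (fun y => cos (b + kap * (w t - y)))
      (kap * sin (b + kap * (w t - y))).
    by apply: is_derive_eq; rewrite /GRing.scale/=; ring.
  exact: is_derive_continuous D.
apply/subspace_continuousP => s st.
move/subspace_continuousP : cw' => /(_ s st) cws.
exact: cvg_comp cws (cg (w s)).
Qed.

Lemma integrable_phase (b : R) :
  mu.-integrable `[0, t] (EFin \o (fun s => cos (b + kap * (w t - w s)))).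
Proof.
apply: measurable_bounded_integrable => //.
- by rewrite /= lebesgue_measure_itv/= lte_fin t0 -EFinB ltry.
- by apply: subspace_continuous_measurable_fun => //; exact: continuous_phase.
- exists 1; split=> // y y1 x _ /=; rewrite (le_trans _ (ltW y1))//.
  exact: normr_cos_le1.
Qed.

(** The path enters only through two numbers, which makes the dependence on [b] explicit. *)
Lemma phase_integralE (b : R) : phase_integral b =
  cos b * phase_integral 0 + sin b * phase_integral (pi / 2).
Proof.
rewrite /phase_integral -!RintegralZl//; [|exact: integrable_phase..].
rewrite -RintegralD//.
- apply: eq_Rintegral => s _.
  rewrite add0r !cosD cos_pihalf sin_pihalf; ring.
- have := @integrableZl _ _ _ mu _ (measurable_itv _) (cos b) _ (integrable_phase 0).
  by apply: eq_integrable => // s _; rewrite /= EFinM.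
- have := @integrableZl _ _ _ mu _ (measurable_itv _) (sin b) _ (integrable_phase (pi / 2)).
  by apply: eq_integrable => // s _; rewrite /= EFinM.
Qed.

Lemma phase_integral_riemann (b : R) :
  t / k.+1.*2%:R * \sum_(a < k.+1.*2) cos (b + kap * (w t - w (t / k.+1.*2%:R * a%:R)))
    @[k --> \oo] --> phase_integral b.
Proof.
apply: (@cvg_riemann_sum _ t 1 (fun s => cos (b + kap * (w t - w s)))) => //.
  by move=> s; exact: normr_cos_le1.
exact: continuous_phase.
Qed.

End phase_integral.

(** Coordinate 1 has no drift, so the trajectory that reaches [x] at time [t] has
    [x_1 - sqrt(2 nu) (w_t - w_s)] as its coordinate 1 at time [s]. Inserted into the drift of
    coordinate 0, this leaves an integral in [x] alone, and the flow equation is solved for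
    [A x]. *)
Lemma shear_inverse_flow (R : realType) (nu al K t : R) (W : R -> 'I_3 -> R)
    (X : R -> 'cV[R]_3 -> 'cV[R]_3) (A : 'cV[R]_3 -> 'cV[R]_3) :
  0 < t -> {within `[0, +oo[, continuous (fun s => W s 1)} ->
  (forall (a : 'cV[R]_3) s, 0 <= s -> forall i, X s a i 0 = a i 0
     + \int[lebesgue_measure]_(r in `[0, s]) shear nu al K (X r a) i 0
     + Num.sqrt (2 * nu) * W s i) ->
  (forall x, X t (A x) = x) ->
  let I := phase_integral (K * Num.sqrt (2 * nu)) t (fun s => W s 1) in
  A = (fun x => \col_i (x i 0 - Num.sqrt (2 * nu) * W t i - (i == 0)%:R *
    (amplitude nu al K * (sin (K * x 1 0) * I 0
                          - cos (K * x 1 0) * - I (pi / 2))))).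
Proof.
move=> t0 cW HX AX I; apply/funext => x; apply/colP => i; rewrite mxE.
have X1 a s : 0 <= s -> X s a 1 0 = a 1 0 + Num.sqrt (2 * nu) * W s 1.
  move=> s0; rewrite HX//; congr (_ + _).
  under eq_Rintegral do rewrite !mxE /= mulr0.
  by rewrite Rintegral_cst// mul0r addr0.
have := HX (A x) t (ltW t0) i; rewrite AX => Exi.
have [i0|i0] := eqVneq i 0; last first.
  rewrite mul0r subr0 Exi.
  under eq_Rintegral do rewrite !mxE (negbTE i0) /= mulr0.
  by rewrite Rintegral_cst// mul0r addr0 addrK.
have A1 : A x 1 0 = x 1 0 - Num.sqrt (2 * nu) * W t 1.
  by have := X1 (A x) t (ltW t0); rewrite AX => ->; rewrite addrK.
rewrite mul1r Exi i0 /=.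
suff -> : \int[lebesgue_measure]_(r in `[0, t]) shear nu al K (X r (A x)) 0 0 =
    amplitude nu al K * (sin (K * x 1 0) * I 0 - cos (K * x 1 0) * - I (pi / 2)).
  by ring.
transitivity (amplitude nu al K * I (- (K * x 1 0) + pi / 2)).
  rewrite /I /phase_integral -RintegralZl//; last exact: integrable_phase.
  apply: eq_Rintegral => s; rewrite inE/= in_itv/= => /andP[s0 _].
  rewrite !mxE/= mulr1 X1// A1; congr (_ * _).
  rewrite [X in _ = cos X]addrAC [RHS]cosD cos_pihalf sin_pihalf mulr0 sub0r mulr1 -sinN; congr sin.
  by ring.
congr (_ * _); rewrite /I phase_integralE// !cosD !sinD cosN sinN cos_pihalf sin_pihalf.
ring.
Qed.

(** * Operator, Hoelder and essential sup norms *)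

Section euclidean_norm.
Context {R : realType}.
Implicit Types (v x y : 'cV[R]_3) (M : 'M[R]_3).

Lemma sqr_enorm v : enorm v ^+ 2 = v 0 0 ^+ 2 + v 1 0 ^+ 2 + v (inord 2) 0 ^+ 2.
Proof.
rewrite sqr_sqrtr; last by apply: sumr_ge0 => i _; exact: sqr_ge0.
rewrite !big_ord_recr big_ord0/= add0r; congr (_ ^+ 2 + _ ^+ 2 + _ ^+ 2);
  congr (v _ 0); apply: val_inj => //=; by rewrite inordK.
Qed.

Lemma enorm_ge0 v : 0 <= enorm v.
Proof. exact: sqrtr_ge0. Qed.

Lemma normr_le_enorm v i : `|v i 0| <= enorm v.
Proof.
rewrite -sqrtr_sqr ler_wsqrtr// (bigD1 i)//= lerDl.
by apply: sumr_ge0 => j _; exact: sqr_ge0.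
Qed.

Lemma enorm0 : enorm (0 : 'cV[R]_3) = 0.
Proof. by rewrite /enorm big1 ?sqrtr0// => i _; rewrite mxE expr0n. Qed.

Lemma opnorm_le M c : (forall v, enorm v <= 1 -> enorm (M *m v) <= c) ->
  opnorm M <= c.
Proof.
move=> Mc; apply: ge_sup.
  by exists (enorm (M *m 0)), 0 => //=; rewrite enorm0.
by move=> _ [v /= v1 <-]; exact: Mc.
Qed.

Lemma opnorm_ge0 M : 0 <= opnorm M.
Proof.
rewrite /opnorm; set E := (X in sup X).
have E0 : E 0 by exists 0; rewrite /= ?mulmx0 enorm0.
(* A set without a supremum has [sup] equal to 0 by convention. *)
have [supE|/sup_out ->//] := pselect (has_sup E).
exact: sup_upper_bound supE _ E0.
Qed.

Lemma opnorm_scale_delta (e : R) : opnorm (e *: delta_mx 0 1) <= `|e|.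
Proof.
apply: opnorm_le => v v1.
have -> : (e *: delta_mx 0 1) *m v = (e * v 1 0) *: (delta_mx 0 0 : 'cV[R]_3).
  rewrite -scalemxAl; apply/colP => i; rewrite !mxE.
  rewrite (bigD1 1)//= big1 => [|j j1]; rewrite !mxE ?eqxx ?andbT ?addr0.
    by rewrite -mulrA; congr (_ * _); rewrite mulrC.
  by rewrite (negbTE j1) andbF mul0r.
apply: (@le_trans _ _ `|e * v 1 0|).
  rewrite -(ger0_norm (enorm_ge0 _)) -ler_sqr ?nnegrE// !real_normK ?num_real//.
  by rewrite sqr_enorm !mxE/= -val_eqE/= inordK//= !mulr0 mulr1 expr0n/= !addr0.
by rewrite normrM ler_piMr// (le_trans (normr_le_enorm v 1)).
Qed.

Lemma sqr_enorm_shear (e : R) v :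
  enorm ((1%:M - e *: delta_mx 0 1) *m v) ^+ 2 =
  (v 0 0 - e * v 1 0) ^+ 2 + v 1 0 ^+ 2 + v (inord 2) 0 ^+ 2.
Proof.
have E i : ((1%:M - e *: delta_mx 0 1) *m v) i 0 = v i 0 - (i == 0)%:R * (e * v 1 0).
  rewrite mulmxBl mul1mx -scalemxAl !mxE; congr (_ - _).
  rewrite (bigD1 1)//= big1 => [|j j1]; rewrite !mxE ?eqxx ?andbT ?addr0.
    by ring.
  by rewrite (negbTE j1) andbF mul0r.
by rewrite sqr_enorm !E/= -[inord 2 == 0]val_eqE/= inordK//= mul1r !mul0r !subr0.
Qed.

Lemma enorm_shear_le (e : R) v : enorm v <= 1 ->
  enorm ((1%:M - e *: delta_mx 0 1) *m v) <= 2 + `|e|.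
Proof.
move=> v1; rewrite -ler_sqr ?nnegrE ?enorm_ge0 ?addr_ge0// sqr_enorm_shear.
have vi i : `|v i 0| <= 1 by rewrite (le_trans (normr_le_enorm v i)).
have vi2 i : v i 0 ^+ 2 <= 1 by rewrite -(real_normK (num_real _)) exprn_ile1.
have E0 := normr_ge0 e.
have : (v 0 0 - e * v 1 0) ^+ 2 <= (1 + `|e|) ^+ 2.
  rewrite -(real_normK (num_real (_ - _))) ler_sqr ?nnegrE ?addr_ge0//.
  rewrite (le_trans (ler_normB _ _))// lerD// normrM ler_piMr//.
have := vi2 1; have := vi2 (inord 2); nra.
Qed.

Lemma opnorm_shear_le (e : R) : opnorm (1%:M - e *: delta_mx 0 1) <= 2 + `|e|.
Proof. by apply: opnorm_le => v; exact: enorm_shear_le. Qed.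

(** The test vector is the basis vector of coordinate 1, whose image has [- e] as coordinate 0.
    [enorm_shear_le] guarantees that [sup] is a true upper bound. *)
Lemma opnorm_shear_ge (e : R) : `|e| <= opnorm (1%:M - e *: delta_mx 0 1).
Proof.
have v1 : enorm (delta_mx 1 0 : 'cV[R]_3) = 1.
  apply/eqP; rewrite -(eqrXn2 (n := 2))// ?enorm_ge0// sqr_enorm !mxE/=.
  by rewrite -val_eqE/= inordK//= expr0n/= !addr0 add0r.
apply: (@le_trans _ _ (enorm ((1%:M - e *: delta_mx 0 1) *m delta_mx 1 0))).
  rewrite -ler_sqr ?nnegrE ?enorm_ge0// sqr_enorm_shear !mxE/=.
  rewrite -val_eqE/= inordK//= sub0r mulr1 sqrrN real_normK ?num_real//.
  by rewrite -addrA lerDl addr_ge0 ?sqr_ge0.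
apply: ub_le_sup; last by exists (delta_mx 1 0) => //=; rewrite v1.
by exists (2 + `|e|) => _ [v /= vle <-]; exact: enorm_shear_le.
Qed.

End euclidean_norm.

Lemma cos_lipschitz (R : realType) (u v : R) : `|cos u - cos v| <= `|u - v|.
Proof.
wlog uv : u v / v <= u => [H|].
  have [|/ltW] := leP v u; first exact: H.
  by move=> /H; rewrite distrC (distrC u).
have [c _ ->] := @MVT_segment R cos (fun x => - sin x) v u uv
  (fun x _ => is_derive_cos x) (continuous_subspaceT (@continuous_cos R)).
by rewrite normrM normrN ler_piMl// normr_sin_le1.
Qed.

Section torus_holder.
Context {R : realType}.
Implicit Types x y : 'cV[R]_3.

Lemma torus_dist_ge c x y :
  (forall m, c <= enorm (x - y - lattice_vec m)) -> c <= torus_dist x y.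
Proof.
move=> h; apply: lb_le_inf; first by exists (enorm (x - y - lattice_vec 0)), 0.
by move=> _ [m _ <-].
Qed.

Lemma torus_dist_ge0 x y : 0 <= torus_dist x y.
Proof. by apply: torus_dist_ge => m; exact: enorm_ge0. Qed.

(** Lattice translations of [y] leave the cosine unchanged, so the Euclidean Lipschitz bound holds
    for every translate and hence for the infimum. *)
Lemma cos_freq_lipschitz n x y :
  `|cos (freq n * x 1 0) - cos (freq n * y 1 0)| <= freq n * torus_dist x y.
Proof.
have K0 : 0 <= freq n :> R by rewrite !mulr_ge0 ?pi_ge0.
have [->|K1] := eqVneq (freq n : R) 0; first by rewrite !mul0r subrr normr0.
have {K0 K1} K0 : 0 < freq n :> R by rewrite lt_neqAle eq_sym K1.
rewrite [leRHS]mulrC -ler_pdivrMr//; apply: torus_dist_ge => m.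
rewrite ler_pdivrMr// -(cos_freq n (y 1 0) (m 1 0)).
rewrite (le_trans (cos_lipschitz _ _))// -mulrBr normrM (gtr0_norm K0) mulrC ler_pM2r//.
have := normr_le_enorm (x - y - lattice_vec m) 1.
by rewrite !mxE opprD addrA.
Qed.

(** Interpolation: the difference of cosines is at most [2] and at most [K r], hence at most
    [2 (K r)^al], and [M K^al <= 1] removes the frequency. The 5 is 3 for the sup norm plus 2 for
    the seminorm. *)
Lemma holder_norm_shear (n : nat) (al M : R) (F : 'cV[R]_3 -> 'M[R]_3) :
  0 < al < 1 -> 0 <= M -> M * freq n `^ al <= 1 -> M <= 1 ->
  (forall x, F x = 1%:M - (M * cos (freq n * x 1 0)) *: delta_mx 0 1) ->
  (holder_norm al F <= 5%:E)%E.
Proof.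
move=> /andP[al0 al1] M0 + M1; set K : R := freq n => MK FE.
have K0 : 0 <= K by rewrite !mulr_ge0 ?pi_ge0.
rewrite /holder_norm (_ : 5%:E = 3%:E + 2%:E)%E; last by congr (_%:E); ring.
apply: leeD; apply: ge_ereal_sup.
  move=> _ [x _ <-]; rewrite lee_fin FE (le_trans (opnorm_shear_le _))//.
  rewrite (_ : 3 = 2 + 1 :> R); last by ring.
  by rewrite lerD2l normrM (ger0_norm M0) mulr_ile1// normr_cos_le1.
move=> _ [[x y] /= dn0 <-]; rewrite lee_fin.
have d0 : 0 < torus_dist x y by rewrite lt_neqAle eq_sym dn0 torus_dist_ge0.
rewrite ler_pdivrMr ?powR_gt0// !FE.
have -> : 1%:M - (M * cos (K * x 1 0)) *: delta_mx 0 1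
    - (1%:M - (M * cos (K * y 1 0)) *: delta_mx 0 1) =
    (M * (cos (K * y 1 0) - cos (K * x 1 0))) *: delta_mx 0 1 :> 'M[R]_3.
  by apply/matrixP => i j; rewrite !mxE; ring.
rewrite (le_trans (opnorm_scale_delta _))// normrM (ger0_norm M0) distrC.
set D := `|_|; set r := torus_dist x y in d0 *.
have DK : D <= K * r by exact: cos_freq_lipschitz.
have D2 : D <= 2.
  by rewrite (le_trans (ler_normB _ _))// -[leRHS]/(1 + 1) lerD ?normr_cos_le1.
have Kr0 : 0 <= K * r by rewrite mulr_ge0// ltW.
have DKr : D <= 2 * (K * r) `^ al.
  have [Kr1|Kr1] := leP (K * r) 1; last first.
    rewrite (le_trans D2)// ler_peMr// -[leLHS](powRr0 (K * r)).
    by rewrite ler_powR// ltW.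
  have p0 := powR_ge0 (K * r) al.
  suff : K * r <= (K * r) `^ al by lra.
  move: Kr0; rewrite le_eqVlt => /predU1P[Kr0|Kr0].
    by rewrite -Kr0 powR_ge0.
  by rewrite -[leLHS]powRr1 ?(ltW Kr0)// ger_powR ?Kr0// ltW.
apply: (@le_trans _ _ (M * (2 * (K * r) `^ al))); first by rewrite ler_wpM2l.
rewrite powRM ?(ltW d0)// (_ : M * _ = 2 * (M * K `^ al) * r `^ al); last by ring.
by rewrite ler_pM2r ?powR_gt0// ger_pMr.
Qed.

End torus_holder.

Section Linfty_lower_bound.
Context {R : realType}.
Local Notation mu := (@lebesgue_measure R).

Let box (r : R) : set (R * R * R) :=
  (`[0, 1]%classic `*` `]- r, r[%classic) `*` `[0, 1]%classic.

Let box_gt0 (r : R) : 0 < r -> (0 < ((mu \x mu) \x mu) (box r))%E.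
Proof.
move=> r0.
have mI : measurable (`[0, 1]%classic : set R) by exact: measurable_itv.
have mJ : measurable (`]- r, r[%classic : set R) by exact: measurable_itv.
have lI : mu `[0, 1]%classic = 1%:E.
  by rewrite lebesgue_measure_itv/= lte_fin ltr01 -EFinB subr0.
have lJ : mu `]- r, r[%classic = (r + r)%:E.
  by rewrite lebesgue_measure_itv/= lte_fin -subr_gt0 opprK addr_gt0// -EFinB opprK.
suff -> : ((mu \x mu) \x mu)%E (box r) = (1%:E * (r + r)%:E * 1%:E)%E.
  by rewrite -!EFinM lte_fin mul1r mulr1 addr_gt0.
have H := @product_measure1E _ _ _ _ R (mu \x mu)%E mu _ _ (measurableX mI mJ) mI.
apply: (etrans H).
congr (_ * _)%E; last exact: lI.
have H' := @product_measure1E _ _ _ _ R mu mu _ _ mI mJ.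
apply: (etrans H').
by congr (_ * _)%E; [exact: lI|exact: lJ].
Qed.

(** Over a space of measure 0 the essential supremum would be [-oo]; the box provides positive
    measure. *)
Lemma Linfty_norm_ge0 (F : 'cV[R]_3 -> 'M[R]_3) : (0 <= Linfty_norm F)%E.
Proof.
apply: ess_sup_gee; last by apply: aeW => p; rewrite lee_fin opnorm_ge0.
apply: lt_le_trans (box_gt0 ltr01) _; apply: le_measure => //; rewrite inE//.
by apply: measurableX => //; exact: measurableX.
Qed.

(** By continuity [|e|] stays above any number less than [|e 0|] on a thin slab around [y = 0], and
    the slab has positive measure. *)
Lemma Linfty_norm_shear_ge (e : R -> R) (F : 'cV[R]_3 -> 'M[R]_3) :
  continuous e -> (forall x, F x = 1%:M - e (x 1 0) *: delta_mx 0 1) ->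
  (`|e 0|%:E <= Linfty_norm F)%E.
Proof.
move=> ce FE; rewrite leNgt; apply/negP => lt.
have [r [lr re]] : exists r, (Linfty_norm F <= r%:E)%E /\ r < `|e 0|.
  move: lt (Linfty_norm_ge0 F); case: (Linfty_norm F) => [r|//|//].
  by rewrite lte_fin => re _; exists r; rewrite lexx.
have /(@cvg_norm _ _ _ _ _ _ _) cn : e x @[x --> (0 : R)] --> e 0 by exact: ce.
have : \forall x \near (0 : R), r < `|e x|.
  by apply: (cvgr_gt _ cn).
move=> /nbhs_ballP[dl /= dl0 dle].
have /ess_supP [N [mN N0 NF]] := lr.
have : (((mu \x mu) \x mu) (box dl) <= 0)%E.
  rewrite -N0; apply: le_measure; rewrite ?inE//.
    by apply: measurableX => //; exact: measurableX.
  move=> [[p1 p2] p3] /= [[_ p2d] _]; apply: NF => /=; rewrite lee_fin.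
  apply/negP; rewrite -ltNge FE (lt_le_trans _ (opnorm_shear_ge _))//.
  rewrite !mxE/=; apply: dle; rewrite /ball/= sub0r normrN.
  by rewrite ltr_norml; move: p2d; rewrite /= in_itv.
by rewrite leNgt box_gt0.
Qed.

End Linfty_lower_bound.

(** * The two estimates *)

Lemma continuous_phase_integral (R : realType) (kap t : R) (w : R -> R) :
  0 < t -> {within `[0, +oo[, continuous w} ->
  continuous (phase_integral kap t w).
Proof.
move=> t0 cw; rewrite (funext (phase_integralE kap t0 cw)) => b.
apply: cvgD; (apply: cvgM; last exact: cvg_cst).
  exact: continuous_cos.
exact: continuous_sin.
Qed.

Section shear_expectation.
Context d (T : measurableType d) (R : realType) (P : probability T R).
Variables (W : R -> 'I_3 -> {RV P >-> R}) (kap t lam : R).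
Hypotheses (BW : brownian_motion W) (t0 : 0 < t) (lamE : kap ^+ 2 / 2 = lam).

Local Notation m k := (k.+1.*2).
Local Notation dt k := (t / (m k)%:R).
Local Notation xi k := (increments W (dt k) 1).
Definition brownian_phase (b : R) (om : T) : R :=
  phase_integral kap t (fun s => W s 1 om) b.

Let F k b om := dt k * \sum_(a < m k) cos (b + tail_walk (m k) kap (xi k) a om).

Let m0 k : 0 < (m k)%:R :> R. Proof. by rewrite ltr0n double_gt0. Qed.
Let dt0 k : 0 < dt k. Proof. by rewrite divr_gt0. Qed.
Let s0 k : 0 < Num.sqrt (dt k). Proof. by rewrite sqrtr_gt0. Qed.
Let iid k : iid_gaussian P (m k) (Num.sqrt (dt k)) (xi k).
Proof. exact: iid_increments. Qed.

Let bF k b : bounded_measurable (F k b).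
Proof.
apply: bounded_measurableM; first exact: bounded_measurable_cst.
apply: bounded_measurable_sum => a; apply: bounded_measurable_cos.
by apply: measurable_funD => //; exact: measurable_tail_walk (iid k) _.
Qed.

Let F_le k b om : `|F k b om| <= t.
Proof.
rewrite normrM (gtr0_norm (dt0 k)) mulrAC ler_pdivrMr// ler_pM2l//.
rewrite (le_trans (ler_norm_sum _ _ _))// -[X in _ <= X%:R]card_ord -sumr_const.
by apply: ler_sum => a _; exact: normr_cos_le1.
Qed.

Let cvg_F : {ae P, forall om, forall b, F k b om @[k --> \oo] --> brownian_phase b om}.
Proof.
have [_ cW _ _] := BW.
apply: filterS cW => om /(_ 1) cw b.
have := @phase_integral_riemann R kap t (fun s => W s 1 om) t0 cw b.
apply: cvg_trans; apply: near_eq_cvg; apply: nearW => k; rewrite /F; congr (_ * _).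
apply: eq_bigr => a _; rewrite tail_walk_increments ?(ltnW (ltn_ord a))//.
by rewrite (divfK (lt0r_neq0 (m0 k))).
Qed.

(** The mean of the Riemann sum at phase 0, a discrete form of the integral of [exp(- lam (t - s))]
    over [[0, t]]. *)
Let mass k : R := dt k * \sum_(a < m k) expR (- (lam * dt k)) ^+ (m k - a).

Let Rintegral_F k b : \int[P]_om F k b om = cos b * mass k.
Proof.
have bc (a : 'I_(m k)) : bounded_measurable
    (fun om => cos (b + tail_walk (m k) kap (xi k) a om)).
  apply: bounded_measurable_cos.
  by apply: measurable_funD => //; exact: measurable_tail_walk (iid k) _.
rewrite bRintegralZ; last exact: bounded_measurable_sum.
rewrite bRintegral_sum// /mass [RHS]mulrCA; congr (_ * _).
rewrite mulr_sumr.
apply: eq_bigr => a _.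
rewrite (Rintegral_cos_tail_walk kap (s0 k) (iid k) _ (ltnW (ltn_ord a))).
congr (_ * expR _ ^+ _); rewrite sqr_sqrtr ?(ltW (dt0 k))// -lamE; field.
by rewrite gt_eqF.
Qed.

Let mass_ge0 k : 0 <= mass k.
Proof.
by rewrite mulr_ge0 ?(ltW (dt0 k))//; apply: sumr_ge0 => a _; rewrite exprn_ge0 ?expR_ge0.
Qed.

(** With [x = lam dt] and [q = exp(- x)], the exponents run from 1 to [m], so the sum is at most
    [q / (1 - q)]; and [(1 + x) q <= 1] means [x q <= 1 - q]. *)
Let mass_le k : 0 < lam -> lam * mass k <= 1.
Proof.
move=> lam0; set q := expR (- (lam * dt k)).
have ldt0 : 0 < lam * dt k by rewrite mulr_gt0.
have q0 : 0 < q by exact: expR_gt0.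
have q1 : q < 1 by rewrite expR_lt1 oppr_lt0.
have q01 : 0 <= q < 1 by rewrite q1 ltW.
rewrite /mass -/q (_ : \sum_(a < m k) _ = (q - q ^+ (m k).+1) / (1 - q)).
  rewrite (mulrA lam) mulrA ler_pdivrMr ?subr_gt0// mul1r.
  apply: (@le_trans _ _ (lam * dt k * q)).
    by rewrite ler_pM2l// lerBlDr lerDl exprn_ge0// ltW.
  have h1 := expR_ge1Dx (lam * dt k).
  have e1 : expR (lam * dt k) * q = 1 by rewrite -expRD subrr expR0.
  have : (1 + lam * dt k) * q <= 1 by rewrite -[leRHS]e1 ler_pM2r.
  by rewrite mulrDl mul1r; lra.
have := sum_geometric_down q01 (m k) (m k); rewrite subSnn expr1 => <-.
by rewrite [RHS]big_mkcond; apply: eq_bigr => a _; rewrite (ltnW (ltn_ord a)).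
Qed.

(** [M] is the limit of [mass k], common to all phases. The affine form of [G] is that of an entry
    of the gradient. *)
Lemma expectation_brownian_phase : exists M : R,
  [/\ 0 <= M, 0 < lam -> lam * M <= 1 &
    forall (G : T -> R) (u v b : R),
      {ae P, forall om, G om = u + v * brownian_phase b om} ->
      ('E_P[G])%E \is a fin_num /\ fine ('E_P[G])%E = u + v * (M * cos b)].
Proof.
have E (G : T -> R) (u v b : R) :
    {ae P, forall om, G om = u + v * brownian_phase b om} ->
    ('E_P[G])%E \is a fin_num /\
    (u + v * (cos b * mass k)) @[k --> \oo] --> fine ('E_P[G])%E.
  move=> GE.
  have bG k : bounded_measurable (fun om => u + v * F k b om).
    apply: bounded_measurableD; first exact: bounded_measurable_cst.
    by apply: bounded_measurableM => //; exact: bounded_measurable_cst.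
  have [|||fG cG] := @expectation_ae_cvg _ T R P (fun k om => u + v * F k b om) G
    (`|u| + `|v| * t).
  - by move=> k; have [] := bG k.
  - move=> k om; rewrite (le_trans (ler_normD _ _))// lerD2l normrM.
    by rewrite ler_wpM2l.
  - apply: filterS2 cvg_F GE => om /(_ b) cF ->.
    by apply: cvgD; [exact: cvg_cst|apply: cvgM; [exact: cvg_cst|exact: cF]].
  split=> //; move: cG; apply: cvg_trans; apply: near_eq_cvg.
  apply: nearW => k; rewrite bRintegralD; last 2 first.
    exact: bounded_measurable_cst.
    by apply: bounded_measurableM => //; exact: bounded_measurable_cst.
  by rewrite Rintegral_probability_cst bRintegralZ// Rintegral_F.
(* This special case shows that [mass k] converges and names the limit. *)
have [_ cM] := E (brownian_phase 0) 0 1 0 (aeW _ (fun om => esym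
  (etrans (add0r _) (mul1r _)))).
set M := fine _ in cM; exists M.
have {}cM : mass k @[k --> \oo] --> M.
  by move: cM; under eq_fun do rewrite cos0 add0r !mul1r.
split.
- rewrite -(cvg_lim _ cM)//; apply: limr_ge; last exact: nearW.
  by apply/cvg_ex; exists M.
- move=> lam0; rewrite -ler_pdivlMl// mulr1 -(cvg_lim _ cM)//; apply: limr_le.
    by apply/cvg_ex; exists M.
  by apply: nearW => k; rewrite -[leRHS]mulr1 ler_pdivlMl// mass_le.
move=> G u v b /E[fG cG]; split=> //.
rewrite -(cvg_lim _ cG)//; apply/cvg_lim => //.
apply: cvgD; first exact: cvg_cst.
apply: cvgM; first exact: cvg_cst.
by rewrite mulrC; apply: cvgM => //; exact: cvg_cst.
Qed.

(** The bound of [walk_sum_lower_bound] does not depend on the mesh and holds once [lam dt <= 1], so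
    it survives the limit. *)
Lemma expectation_normr_brownian_phase_ge (v : R) : 2 <= lam * t ->
  ((`|v| * (Num.sqrt (t / lam) / 512))%:E <=
  \int[P]_om (`|v * brownian_phase 0 om|)%:E)%E.
Proof.
move=> lt2; have lam0 : 0 < lam by rewrite -(pmulr_lgt0 _ t0) (lt_le_trans _ lt2).
have bvF k : bounded_measurable (fun om => v * F k 0 om).
  by apply: bounded_measurableM => //; exact: bounded_measurable_cst.
have mvF k : measurable_fun [set: T] (fun om => `|v * F k 0 om|).
  by apply: measurableT_comp => //; have [] := bvF k.
have [||fG cG] := @expectation_ae_cvg _ T R P (fun k om => `|v * F k 0 om|)
    (fun om => `|v * brownian_phase 0 om|) (`|v| * t) mvF.
- by move=> k om; rewrite normr_id normrM ler_wpM2l.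
- apply: filterS cvg_F => om /(_ 0) cF.
  by apply: cvg_norm; apply: cvgM => //; exact: cvg_cst.
have -> : (\int[P]_om (`|v * brownian_phase 0 om|)%:E =
    'E_P[fun om => `|v * brownian_phase 0 om|%R ])%E by rewrite unlock.
rewrite -(fineK fG) lee_fin -(cvg_lim _ cG)//; apply: limr_ge.
  by apply/cvg_ex; eexists; exact: cG.
have ldt : \forall k \near \oo, lam * (t / k.+1.*2%:R) <= 1.
  exists (Num.truncn (lam * t)) => // k /= kt.
  rewrite mulrA ler_pdivrMr// mul1r (le_trans (ltW (truncnS_gt _)))//.
  by rewrite ler_nat -addnn (leq_trans _ (leq_addr _ _)).
near=> k.
have ldt1 : lam * dt k <= 1 by near: k.
have k0 : (0 < k.+1)%N by [].
have := walk_sum_lower_bound lamE k0 t0 lt2 ldt1 (iid k).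
move=> /(ler_wpM2l (normr_ge0 v)) /le_trans; apply.
rewrite -bRintegralZ; last first.
  have [mX [M XM]] := bounded_measurableM (@bounded_measurable_cst _ T _ (dt k))
    (bounded_measurable_walk_sum kap (iid k)).
  split; last by exists M => x; rewrite normr_id.
  exact: (measurableT_comp (@normr_measurable _ _)).
rewrite le_eqVlt; apply/orP; left; apply/eqP; apply: eq_Rintegral => om _.
rewrite -normrM /F /walk_sum; congr (`|v * (_ * _)|).
by apply: eq_bigr => a _; rewrite add0r.
Unshelve. all: by end_near. Qed.

End shear_expectation.

Lemma freq_ge1 (R : realType) (n : nat) : (0 < n)%N -> 1 <= freq n :> R.
Proof.
move=> n0; have p2 := @pi_ge2 R.
have n1 : 1 <= n%:R :> R by rewrite ler1n.
rewrite /freq -[leLHS]mulr1 ler_pM// -[leLHS]mulr1 ler_pM// ?ler1n//.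
by rewrite (le_trans _ p2)// ler1n.
Qed.

Section shear_flow.
Context d (T : measurableType d) (R : realType) (P : probability T R).
Variables (W : R -> 'I_3 -> {RV P >-> R}) (X A : R -> 'cV[R]_3 -> T -> 'cV[R]_3).
Variables (t nu al K : R).
Hypotheses (t0 : 0 < t) (BW : brownian_motion W).
Hypotheses (flowX : stochastic_flow nu (shear nu al K) W X).
Hypothesis (invA : inverse_flow P X A).

Local Notation phase := (brownian_phase W (K * Num.sqrt (2 * nu)) t).
Local Notation k := (amplitude nu al K * K).

Lemma grad_inverse_flow : {ae P, forall om, forall x,
  grad (A t ^~ om) x = 1%:M - (k * phase (- (K * x 1 0)) om) *: delta_mx 0 1}.
Proof.
have [_ cW _ _] := BW.
near=> om => x.
have /(_ 1) cw : forall i, {within `[0, +oo[, continuous (fun t => W t i om)}.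
  by near: om.
have Hinv : cancel (fun a => X t a om) (fun a => A t a om) /\
    cancel (fun a => A t a om) (fun a => X t a om).
  have : forall t, 0 <= t -> cancel (fun a => X t a om) (fun a => A t a om) /\
    cancel (fun a => A t a om) (fun a => X t a om) by near: om.
  by apply; exact: ltW.
have HX : forall a : 'cV[R]_3,
    [/\ X 0 a om = a,
        {within `[0, +oo[, continuous (fun t => X t a om)}
      & forall t, 0 <= t -> forall i,
          X t a om i 0 = a i 0
            + \int[lebesgue_measure]_(s in `[0, t]) shear nu al K (X s a om) i 0
            + Num.sqrt (2 * nu) * W t i om] by near: om.
have -> := @shear_inverse_flow R nu al K t (fun s i => W s i om)
  (fun s a => X s a om) (A t ^~ om) t0 cw (fun a => let: And3 _ _ h := HX a in h) Hinv.2.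
rewrite grad_shear_inverse; congr (_ - _ *: _).
rewrite /brownian_phase (phase_integralE _ t0 cw (- (K * x 1 0))) cosN sinN.
ring.
Unshelve. all: by end_near. Qed.

Hypothesis nu0 : 0 < nu.

Let kapE : (K * Num.sqrt (2 * nu)) ^+ 2 / 2 = nu * K ^+ 2.
Proof. by rewrite exprMn sqr_sqrtr ?mulr_ge0 ?(ltW nu0)//; field. Qed.

Lemma mean_grad_inverse_flow : exists M : R,
  [/\ 0 <= M, 0 < nu * K ^+ 2 -> nu * K ^+ 2 * M <= 1,
      mean_grad_exists P (A t) &
      forall x, mean_grad P (A t) x =
        1%:M - (k * M * cos (K * x 1 0)) *: delta_mx 0 1].
Proof.
have [M [M0 ML ME]] := expectation_brownian_phase BW t0 kapE.
exists M.
have E x i j : ('E_P[grad_entry (A t) x i j])%E \is a fin_num /\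
    fine ('E_P[grad_entry (A t) x i j])%E =
    (i == j)%:R + - (k * ((i == 0) && (j == 1))%:R) * (M * cos (- (K * x 1 0))).
  apply: ME; apply: filterS grad_inverse_flow => om /(_ x) Gx.
  by rewrite /grad_entry Gx !mxE; ring.
split=> //; first by move=> x i j; have [] := E x i j.
move=> x; apply/matrixP => i j; rewrite !mxE; have [_ ->] := E x i j.
by rewrite cosN; ring.
Qed.

(** [K^(1 - al) K^al = K] turns [nu K^2 M <= 1] into the Hoelder condition. For [n > 0] one has
    [K >= 1], so the amplitude itself is at most 1; for [n = 0] it vanishes. *)
Lemma holder_norm_mean_grad n : K = freq n -> 0 < al < 1 ->
  (holder_norm al (mean_grad P (A t)) <= 5%:E)%E.
Proof.
move=> Kn al01; have [M [M0 ML _ ME]] := mean_grad_inverse_flow.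
have /andP[al0 al1] := al01.
have K0 : 0 <= K by rewrite Kn !mulr_ge0 ?pi_ge0.
have k0 : 0 <= k by rewrite !mulr_ge0 ?powR_ge0// ltW.
have kM0 : 0 <= k * M by rewrite mulr_ge0.
have kMK : k * M * K `^ al <= 1.
  have [->|Kn0] := eqVneq K 0; first by rewrite mulr0 !mul0r.
  have K1 : 0 < K by rewrite lt_neqAle eq_sym Kn0.
  have -> : k * M * K `^ al = nu * K * (K `^ (1 - al) * K `^ al) * M.
    by rewrite /amplitude; ring.
  rewrite -powRD ?subrK; last by rewrite Kn0 implybT.
  by rewrite powRr1// -[nu * K * K]mulrA -expr2 ML// mulr_gt0// exprn_gt0.
apply: (@holder_norm_shear _ n al (k * M)); rewrite -?Kn//.
have [Kz|Kn0] := eqVneq K 0; first by rewrite Kz mulr0 mul0r.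
have K1 : 1 <= K.
  rewrite Kn freq_ge1// lt0n; apply: contra_neq Kn0 => n0.
  by rewrite Kn n0 /freq mulr0.
rewrite (le_trans _ kMK)// ler_peMr// -[leLHS](powRr0 K) ler_powR//.
exact: ltW.
Qed.

Lemma mean_Linfty_grad_ge : 0 <= K -> 2 <= nu * K ^+ 2 * t ->
  ((512^-1 * Num.sqrt (nu * t) * K `^ (1 - al))%:E <= mean_Linfty_grad P (A t))%E.
Proof.
move=> K0 lt2.
have Kn0 : 0 < K.
  rewrite lt_neqAle K0 andbT eq_sym; apply: contraTneq lt2 => ->.
  by rewrite expr0n/= mulr0 mul0r -ltNge.
have k0 : 0 <= k by rewrite !mulr_ge0 ?powR_ge0// ltW.
have [_ cW _ _] := BW.
apply: le_trans (le_trans (expectation_normr_brownian_phase_ge BW t0 kapE k lt2) _).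
  rewrite lee_fin (ger0_norm k0).
  have -> : Num.sqrt (t / (nu * K ^+ 2)) = Num.sqrt (nu * t) / (nu * K).
    rewrite (_ : t / (nu * K ^+ 2) = nu * t / (nu * K) ^+ 2); last first.
      by field; rewrite !gt_eqF.
    rewrite sqrtrM ?mulr_ge0 ?(ltW nu0) ?(ltW t0)// sqrtrV ?sqr_ge0//.
    by rewrite sqrtr_sqr ger0_norm// mulr_ge0// ltW.
  by rewrite le_eqVlt; apply/orP; left; apply/eqP; rewrite /amplitude; field; rewrite !gt_eqF.
(* The essential supremum is not known to be measurable in [om]. *)
apply: ge0_ae_le_integral => [om|om|].
- by rewrite lee_fin.
- exact: Linfty_norm_ge0.
apply: filterS2 grad_inverse_flow cW => om Gx /(_ 1) cw.
have := @Linfty_norm_shear_ge R (fun u => k * phase (- (K * u)) om)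
  (grad (A t ^~ om)) _ Gx.
rewrite mulr0 oppr0; apply => u.
apply: cvgM; first exact: cvg_cst.
apply: (cvg_comp (fun u : R => - (K * u)) (brownian_phase W _ t ^~ om)).
  by apply: (@cvgN _ R^o); apply: cvgM; [exact: cvg_cst|exact: cvg_id].
exact: continuous_phase_integral.
Qed.

End shear_flow.

Lemma cvg_freq_powR (R : realType) (c r : R) : 0 < c -> 0 < r ->
  c * freq n `^ r @[n --> \oo] --> +oo.
Proof.
move=> c0 r0; apply/cvgryPge => B.
(* The solution of [c D^r = B], with [max] for negative [B]. Since [freq n >= n], the integer part
   of [D] gives the threshold. *)
pose D := (Num.max 0 (B / c)) `^ r^-1.
exists (Num.truncn D).+1 => // n /= Dn.
have n0 : (0 < n)%N by exact: leq_trans Dn.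
rewrite mulrC -ler_pdivrMr//.
apply: (@le_trans _ _ (Num.max 0 (B / c))); first by rewrite le_max lexx orbT.
have M0 : 0 <= Num.max 0 (B / c) by rewrite le_max lexx.
rewrite -[leLHS]powRr1// -(mulVf (lt0r_neq0 r0)) powRrM.
have D0 : 0 <= D by exact: powR_ge0.
have Dfreq : D <= freq n.
  rewrite (le_trans (ltW (truncnS_gt _)))//.
  apply: (@le_trans _ _ n%:R); first by rewrite ler_nat.
  rewrite /freq ler_peMl//; have := @pi_ge2 R; lra.
by rewrite ge0_ler_powR ?nnegrE ?(ltW r0)// (le_trans D0).
Qed.

Theorem proposition6p3 (R : realType) :
  exists c : R, 0 < c /\
  forall al : R, 0 < al < 1 ->
  exists C : R,
  forall t0 nu : R, 0 < t0 -> 0 < nu ->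
    (forall n : nat,
      let K : R := freq n in
      [/\ z3_periodic (shear nu al K),
          (forall i, smooth3 (component (shear nu al K) i)),
          (forall x, divergence (shear nu al K) x = 0)
        & forall (d : measure_display) (Om : measurableType d)
            (P : probability Om R) (W : R -> 'I_3 -> {RV P >-> R})
            (X A : R -> 'cV[R]_3 -> Om -> 'cV[R]_3),
            brownian_motion W ->
            stochastic_flow nu (shear nu al K) W X ->
            inverse_flow P X A ->
            [/\ mean_grad_exists P (A t0),
                (holder_norm al (mean_grad P (A t0)) <= C%:E)%E
              & 2 <= nu * K ^+ 2 * t0 ->
                ((c * Num.sqrt (nu * t0) * K `^ (1 - al))%:E
                  <= mean_Linfty_grad P (A t0))%E]]) /\
    (fun n : nat => c * Num.sqrt (nu * t0) * freq n `^ (1 - al)) @ \oo --> +oo.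
Proof.
have [c c0 cE] : exists2 c : R, 0 < c & c = 512^-1.
  by exists 512^-1; [rewrite invr_gt0 ltr0n|].
exists c; split; first exact: c0.
move=> al al01; have /andP[al0 al1] := al01.
exists 5 => t0 nu t00 nu0; split; last first.
  apply: cvg_freq_powR; last by rewrite subr_gt0.
  by apply: mulr_gt0; [exact: c0|rewrite sqrtr_gt0 mulr_gt0].
move=> n K; split.
- exact: z3_periodic_shear.
- exact: smooth3_shear.
- exact: divergence_shear.
move=> d Om P W X A BW flowX invA; split.
- by have [M []] := mean_grad_inverse_flow t00 BW flowX invA nu0.
- exact: (holder_norm_mean_grad t00 BW flowX invA nu0 (n := n)).
- rewrite cE; apply: (mean_Linfty_grad_ge t00 BW flowX invA nu0).
  by rewrite !mulr_ge0 ?pi_ge0.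
Qed.
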